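(* Let $A$ be a Borel space and let $(\mathbf{W},\boldsymbol{\eta})=(\mathbf{W}_n,\eta_n)_{n\ge1}$ be an ergodic GEWP over $A$. Then the backward filtration $(\mathcal{F}_n)_{n\ge1}$, $\mathcal{F}_n:=\sigma(\mathbf{W}_k,\eta_{k+1}:k\ge n)$, generated by $(\mathbf{W},\boldsymbol{\eta})$ is of product-type.
   Context: A measurable space $S$ is a Borel space if there are a Borel subset $E\subseteq[0,1]$ and a bijection $f:S\to E$ with $f,f^{-1}$ measurable. $[n]=\{1,\dots,n\}$. For a word $\mathbf{w}=(w_1,\dots,w_n)\in A^n$ and $i\in[n]$, $\mathtt{erase}(\mathbf{w},i)=(w_1,\dots,w_{i-1},w_{i+1},\dots,w_n)\in A^{n-1}$. A general erased-word process (GEWP) over $A$ is a stochastic process $(\mathbf{W}_n,\eta_n)_{n\ge1}$ such that for each $n$: (i) $\mathbf{W}_n$ is a random word in $A^n$; (ii) $\eta_n$ is uniform on $[n]$ and independent of $\mathcal{F}_n:=\sigma(\mathbf{W}_k,\eta_{k+1}:k\ge n)$; (iii) $\mathbf{W}_n=\mathtt{erase}(\mathbf{W}_{n+1},\eta_{n+1})$ almost surely. A GEWP is ergodic if its law is an extreme point of the convex set of all laws of GEWPs over $A$; equivalently, if $\bigcap_{n\ge1}\mathcal{F}_n$ is almost surely trivial (contains only events of probability $0$ or $1$). For sub-$\sigma$-fields $\mathcal{F},\mathcal{G}$ of a probability space $(\Omega,\mathcal{A},\mathbb{P})$ write $\mathcal{F}\overset{a.s.}{=}\mathcal{G}$ if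 each event of one differs from some event of the other by a $\mathbb{P}$-null set. A backward filtration is a decreasing sequence $\mathcal{F}_1\supseteq\mathcal{F}_2\supseteq\cdots$ of sub-$\sigma$-fields. It is of product-type if there exists a sequence of independent random variables $(\xi_n)_{n\ge1}$, defined on $(\Omega,\mathcal{A},\mathbb{P})$, such that $\mathcal{F}_n\overset{a.s.}{=}\sigma(\xi_k:k\ge n+1)$ for all $n\ge 1$. *)

(* Defs.v *)
From HB Require Import structures.
From mathcomp Require Import all_boot all_order all_algebra.
From mathcomp Require Import all_classical all_reals all_analysis.

Set Implicit Arguments.
Unset Strict Implicit.
Unset Printing Implicit Defensive.

Import Order.TTheory GRing.Theory Num.Theory.
Import numFieldNormedType.Exports.

Local Open Scope classical_set_scope.
Local Open Scope ring_scope.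

(* Indexing: sequences that are indexed by n >= 1 in the mathematical text are
   indexed here by nat, the term of index n standing for the term of index
   n + 1; likewise 'I_n.+1 = {0, ..., n} stands for {1, ..., n + 1}.  Thus
   W n, eta n, gewp_filtration W eta n and xi n are W_{n+1}, eta_{n+1},
   F_{n+1} and xi_{n+1}. *)

(* A measurableType is inhabited.  Since E is Borel, the measurable subsets of
   the subspace E are the Borel sets included in E, so the last clause is the
   measurability of the inverse bijection from E to S. *)
Definition borel_space (R : realType) d (S : measurableType d) : Prop :=
  exists (E : set R) (f : S -> R),
    [/\ measurable E, E `<=` `[0, 1], set_bij [set: S] E f,
        measurable_fun [set: S] f &
        forall B : set S, measurable B -> measurable (f @` B)].

HB.instance Definition _ (n : nat) := isPointed.Build 'I_n.+1 ord0.
HB.instance Definition _ (n : nat) := @isMeasurable.Build default_measure_display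
  'I_n.+1 discrete_measurable discrete_measurable0
  discrete_measurableC discrete_measurableU.

Definition erase (A : Type) n (w : n.+1.-tuple A) (i : 'I_n.+1) : n.-tuple A :=
  [tuple tnth w (lift i j) | j < n].

(* The space of trajectories, with the product sigma-algebra. *)
Section path_space.
Context d (A : measurableType d).

Definition gewp_state (n : nat) : Type := (n.+1.-tuple A * 'I_n.+1)%type.
HB.instance Definition _ n := Measurable.on (gewp_state n).

Definition cylinders : set (set (forall n, gewp_state n)) :=
  \bigcup_n preimage_set_system setT
    (fun w : forall n, gewp_state n => w n) measurable.

Definition path_space := g_sigma_algebraType cylinders.
HB.instance Definition _ := Measurable.on path_space.

End path_space.
Arguments cylinders {d} A.

Section gewp.
Context (R : realType) dA (A : measurableType dA)
  d (Omega : measurableType d) (P : probability Omega R).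
Variables (W : forall n, {RV P >-> n.+1.-tuple A})
  (eta : forall n, {RV P >-> 'I_n.+1}).

Definition gewp_filtration (n : nat) : set (set Omega) :=
  <<s \bigcup_(k in [set k | (n <= k)%N])
        (preimage_set_system setT (W k) measurable `|`
         preimage_set_system setT (eta k.+1) measurable) >>.

Definition is_gewp : Prop := forall n,
  [/\ forall i, P (eta n @^-1` [set i]) = (n.+1%:R^-1)%:E,
      forall (J : set 'I_n.+1) (B : set Omega),
        measurable J -> gewp_filtration n B ->
        P (eta n @^-1` J `&` B) = (P (eta n @^-1` J) * P B)%E &
      {ae P, forall x, W n x = erase (W n.+1 x) (eta n.+1 x)}].

Definition path_of (x : Omega) : path_space A := fun n => (W n x, eta n x).

Lemma path_of_measurable : measurable_fun [set: Omega] path_of.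
Proof.
apply: (@measurability _ _ Omega (path_space A) setT path_of (cylinders A) erefl).
move=> _ [_ [n _ [B mB <-]] <-].
have mf : measurable_fun [set: Omega]
    (fun x => (W n x, eta n x) : n.+1.-tuple A * 'I_n.+1).
  by apply/measurable_fun_pair; exact: measurable_funPT.
by have := mf measurableT B mB; rewrite !setTI.
Qed.

HB.instance Definition _ := isMeasurableFun.Build _ _ _ _
  path_of path_of_measurable.

Definition process_law : probability (path_space A) R :=
  distribution P path_of.

End gewp.

Definition same_law d (S : measurableType d) (R : realType)
    (mu nu : probability S R) : Prop :=
  forall B, measurable B -> mu B = nu B.

Definition gewp_laws (R : realType) dA (A : measurableType dA) :
    set (probability (path_space A) R) :=
  [set mu | exists d (Omega : measurableType d) (P : probability Omega R)
      (W : forall n, {RV P >-> n.+1.-tuple A})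
      (eta : forall n, {RV P >-> 'I_n.+1}),
      is_gewp W eta /\ same_law mu (process_law W eta)].

Definition extreme_point d (S : measurableType d) (R : realType)
    (C : set (probability S R)) (mu : probability S R) : Prop :=
  C mu /\
  forall (mu1 mu2 : probability S R) (t : R),
    C mu1 -> C mu2 -> 0 < t < 1 ->
    (forall B, measurable B ->
       mu B = (t%:E * mu1 B + (1 - t)%:E * mu2 B)%E) ->
    same_law mu1 mu /\ same_law mu2 mu.

Definition ergodic_gewp (R : realType) dA (A : measurableType dA)
    d (Omega : measurableType d) (P : probability Omega R)
    (W : forall n, {RV P >-> n.+1.-tuple A})
    (eta : forall n, {RV P >-> 'I_n.+1}) : Prop :=
  is_gewp W eta /\ extreme_point (@gewp_laws R dA A) (process_law W eta).

Section product_type.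
Context (R : realType) d (Omega : measurableType d) (P : probability Omega R).

Definition independent_RVs (xi : nat -> {RV P >-> R}) : Prop :=
  forall (s : seq nat) (B : nat -> set R),
    uniq s -> (forall k, measurable (B k)) ->
    P (\bigcap_(k in [set` s]) (xi k @^-1` B k)) =
    (\prod_(k <- s) P (xi k @^-1` B k))%E.

Definition as_eq (F G : set (set Omega)) : Prop :=
  (forall B, F B -> exists2 C, G C & P (B `+` C) = 0%E) /\
  (forall C, G C -> exists2 B, F B & P (B `+` C) = 0%E).

Definition backward_filtration (F : nat -> set (set Omega)) : Prop :=
  forall n, [/\ sigma_algebra setT (F n), F n `<=` measurable &
                F n.+1 `<=` F n].

Definition product_type (F : nat -> set (set Omega)) : Prop :=
  backward_filtration F /\
  exists xi : nat -> {RV P >-> R}, independent_RVs xi /\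
    forall n, as_eq (F n)
      <<s \bigcup_(k in [set k | (n.+1 <= k)%N])
            preimage_set_system setT (xi k) measurable >>.

End product_type.

(* Main.v *)
Require Import Defs.
From HB Require Import structures.
From mathcomp Require Import all_boot all_order all_algebra.
From mathcomp Require Import all_classical all_reals all_analysis.
From mathcomp Require Import measurable_realfun.
From mathcomp Require Import ring lra zify.

(** Write F_n for the history of the process from time n on.  The mark eta_n is
    uniform and independent of F_n, and F_(n-1) is generated by F_n and eta_n,
    but the marks eta_k, k > n, in general say nothing about the letters of
    W_n.  The proof replaces eta_n by another mark with the same properties,
    which does see the letters.

    Reading the erasures backwards, a letter of W_n is pushed to the right by
    uniform insertions, and its position in W_N divided by N + 1 is a bounded
    martingale in N.  Hence it has an asymptotic relative position u, and
    distinct letters have distinct ones because the distance between two of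
    them in W_N takes each value with probability at most n/N ([cut_cvg],
    [gap_law], [below_separates]).  The pair of u and of the letter itself
    is written as a binary sequence, the code of the letter.  Codes are
    compared lexicographically, and the new mark, [resorted], is the rank of
    the erased letter among the codes of the letters of W_n.  As the codes of
    W_n are known from F_n and are distinct, ranking them only permutes the
    positions of W_n in a way known from F_n, so the new mark is again uniform
    and independent of F_n ([resorted_innovation]).  In particular the new
    marks are independent.

    It remains to recover F_n from the new marks of times k > n.  They tell
    which position the i-th smallest code of W_n occupies among the sorted
    codes of W_N.  For a threshold t, that code is below t exactly when this
    position is at most the number of codes of W_N below t.  The proportion of
    codes of W_N below t is a reversed martingale; its limit is measurable
    with respect to the tail of (F_n), hence a constant c when the process is
    ergodic ([below_cvg_cst]).  So, outside an event of small probability, the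
    code is below t exactly when its position is at most c N: the sorted
    position is unlikely to be close to c N, again because it takes each value
    with probability at most n/N.  Letting N tend to infinity, the sorted
    codes of W_n are a.s. functions of the new marks of times k > n
    ([vpos_lt_completion]).  Each code contains its asymptotic position, so
    the sorted codes also give the order in which their letters stand in W_n,
    and therefore W_n and the original marks.

    Ergodicity enters only through [tail_trivial]: conditioning on a tail
    event and on its complement writes the law of the process as a mixture of
    two laws of the same kind. *)

Set Implicit Arguments.
Unset Strict Implicit.
Unset Printing Implicit Defensive.

Import Order.TTheory GRing.Theory Num.Theory.
Import numFieldNormedType.Exports.

(** * Ranks in finite sequences of distinct elements *)

Lemma sum_itv K p q : (p <= q)%N -> (q <= K)%N ->
  (\sum_(c < K) (p <= c < q)%N)%N = (q - p)%N.
Proof.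
elim: K p q => [|K IH] p q pq qK; first by rewrite big_ord0; lia.
rewrite big_ord_recr/=; move: qK; rewrite leq_eqVlt => /predU1P[qK|qK].
  have [pK|pK] := leqP p K; last first.
    rewrite big1 => [|i _]; first by lia.
    by have := ltn_ord i; lia.
  rewrite (eq_bigr (fun c : 'I_K => (p <= c < K)%N : nat)) => [|i _].
    by rewrite IH//; lia.
  by have := ltn_ord i; case: (leqP p i) => //= _; lia.
by rewrite IH//; lia.
Qed.

Lemma sum_ltn K a : (a <= K)%N -> (\sum_(c < K) (c < a) = a)%N.
Proof. by move=> aK; have := sum_itv (leq0n a) aK; rewrite subn0. Qed.

Section lex.

(** The lexicographic order is chosen for the codes because comparison with
    the countably many thresholds [lexstop s l] determines every bit. *)
Definition lexlt (b c : nat -> bool) : bool :=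
  `[< exists l, (forall k, (k < l)%N -> b k = c k) /\ (b l = false /\ c l = true) >].

Lemma lexlt_irr b : lexlt b b = false.
Proof. by apply/asboolP => -[l [_ [->]]]. Qed.

Lemma lexlt_trans : transitive lexlt.
Proof.
move=> c b e /asboolP[l [hl [bl cl]]] /asboolP[m [hm [cm em]]]; apply/asboolP.
have [lm|ml|lm] := ltngtP l m.
- exists l; split; last by rewrite -hm.
  by move=> k kl; rewrite hl// hm// (ltn_trans kl).
- exists m; split; last by rewrite hl.
  by move=> k km; rewrite hl ?hm// (ltn_trans km).
- by subst m; rewrite cl in cm.
Qed.

Lemma lexlt_total b c : (exists l, b l != c l) -> lexlt b c || lexlt c b.
Proof.
move=> h; have [m hm mmin] := find_ex_minn h.
have eqm k : (k < m)%N -> b k = c k.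
  by move=> km; apply/eqP; apply: contraTT km => /mmin; rewrite -leqNgt.
apply/orP; case bm : (b m) hm; case cm : (c m) => // _.
- by right; apply/asboolP; exists m; split=> // k /eqm.
- by left; apply/asboolP; exists m.
Qed.

(** The sequence s(0), ..., s(l-1), 1, 0, 0, ... *)
Definition lexstop (s : nat -> bool) (l k : nat) : bool :=
  if (k < l)%N then s k else k == l.

(** Once the first l bits are known, one comparison yields the next bit. *)
Lemma lexlt_stop (s b : nat -> bool) l : (forall k, (k < l)%N -> b k = s k) ->
  lexlt b (lexstop s l) = ~~ b l.
Proof.
move=> hb; apply/asboolP/idP => [[m [hm [bm sm]]]|bl].
  have [ml|lm|<-] := ltngtP m l; last by rewrite bm.
    by move: sm; rewrite /lexstop ml -hb// bm.
  by move: sm; rewrite /lexstop ltnNge (ltnW lm)/= gtn_eqF.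
exists l; rewrite /lexstop ltnn eqxx; split; last by split=> //; exact/negbTE.
by move=> k kl; rewrite kl hb.
Qed.

End lex.

Section rank.
Context {V : Type} (lt : rel V).
Hypotheses (lt_irr : forall a, lt a a = false) (lt_trans : transitive lt).

Definition rank (w : nat -> V) (n j : nat) : nat := \sum_(k < n.+1) lt (w k) (w j).

(** For a strict order, distinctness of the terms 0, ..., n is expressed by
    their pairwise comparability. *)
Definition rank_separated (w : nat -> V) (n : nat) :=
  forall i j, (i <= n)%N -> (j <= n)%N -> i != j -> lt (w i) (w j) || lt (w j) (w i).

Lemma lt_asym a b : lt a b -> lt b a = false.
Proof. by move=> ab; apply/negP => /(lt_trans ab); rewrite lt_irr. Qed.

Lemma rank_le w n j : (j <= n)%N -> (rank w n j <= n)%N.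
Proof.
move=> jn; rewrite /rank (bigD1 (Ordinal (jn : (j < n.+1)%N)))//= lt_irr add0n.
apply: (@leq_trans (\sum_(i < n.+1 | i != Ordinal (jn : (j < n.+1)%N)) 1)%N).
  by apply: leq_sum => i _; case: (lt _ _).
by rewrite sum1_card cardC1 card_ord.
Qed.

(** The rank of w i turns the comparison of w i with a threshold, possibly not
    among the terms, into a comparison of numbers: w i itself is counted below
    the threshold exactly when it is smaller. *)
Lemma rank_lt w n i t : (i <= n)%N -> rank_separated w n ->
  lt (w i) t = (rank w n i < \sum_(k < n.+1) lt (w k) t)%N.
Proof.
move=> iN sep; pose i' := Ordinal (iN : (i < n.+1)%N).
case: (boolP (lt (w i) t)) => [it|nit]; apply/esym.
  rewrite /rank (bigD1 i')//= [X in (_ < X)%N](bigD1 i')//= it lt_irr ltnS.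
  apply: leq_sum => k _; case ki : (lt (w k) (w i)) => //.
  by rewrite (lt_trans ki it).
apply/negbTE; rewrite -leqNgt; apply: leq_sum => k _.
case kt : (lt (w k) t) => //.
have [ki|ki] := eqVneq (k : nat) i; first by rewrite -ki kt in nit.
have kn : (k <= n)%N by rewrite -ltnS.
have /orP[->//|ik] := sep _ _ kn iN ki.
by rewrite (lt_trans ik kt) in nit.
Qed.

Lemma rank_inj w n : rank_separated w n ->
  forall i j, (i <= n)%N -> (j <= n)%N -> rank w n i = rank w n j -> i = j.
Proof.
move=> sep i j iN jn e; apply/eqP; apply: contraT => ij.
by have /orP[] := sep i j iN jn ij; rewrite (rank_lt _ _ sep)// -/(rank w n _) e ltnn.
Qed.

Lemma rank_bij w n i : rank_separated w n -> (i <= n)%N ->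
  exists2 j, (j <= n)%N & rank w n j = i.
Proof.
move=> sep iN.
pose f (j : 'I_n.+1) : 'I_n.+1 := inord (rank w n j).
have fE j : f j = rank w n j :> nat.
  by rewrite inordK// ltnS rank_le// -ltnS.
have finj : injective f.
  move=> j k /(congr1 val); rewrite /= !fE => e.
  by apply/val_inj; apply: (rank_inj sep) e; rewrite -ltnS.
have [g fg gf] := injF_bij finj.
exists (g (inord i)); first by rewrite -ltnS.
by rewrite -fE gf inordK.
Qed.

Lemma rank_sum1 w n i : rank_separated w n -> (i <= n)%N ->
  (\sum_(j < n.+1) (rank w n j == i) = 1)%N.
Proof.
move=> sep iN; have [j jn e] := rank_bij sep iN.
rewrite (bigD1 (Ordinal (jn : (j < n.+1)%N)))//= e eqxx big1// => k kj.
case: eqP => // ki; move: kj; rewrite -val_eqE/= => /eqP[].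
by apply: (rank_inj sep); rewrite ?ki// -ltnS.
Qed.

(** The inverse permutation of [rank], as a sum with one nonzero term, so that
    its measurability follows from that of the ranks. *)
Definition unrank (w : nat -> V) (n i : nat) : nat :=
  \sum_(j < n.+1) j * (rank w n j == i).

Lemma rankK w n j : rank_separated w n -> (j <= n)%N -> unrank w n (rank w n j) = j.
Proof.
move=> sep jn; rewrite /unrank (bigD1 (Ordinal (jn : (j < n.+1)%N)))//= eqxx muln1.
rewrite big1 ?addn0// => k kj; case: eqP => [e|]; last by rewrite muln0.
move: kj; rewrite -val_eqE/= => /eqP[].
by apply: (rank_inj sep) e; rewrite -ltnS.
Qed.

Lemma unrankK w n i : rank_separated w n -> (i <= n)%N ->
  (unrank w n i <= n)%N /\ rank w n (unrank w n i) = i.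
Proof. by move=> sep iN; have [j jn <-] := rank_bij sep iN; rewrite rankK. Qed.

(** A permutation takes each value once.  This gives the position of the
    element of rank i when only the relative order of the positions is
    known. *)
Lemma unrank_count w n i : rank_separated w n -> (i <= n)%N ->
  (\sum_(k < n.+1) (unrank w n k < unrank w n i) = unrank w n i)%N.
Proof.
move=> sep iN; have [un _] := unrankK sep iN.
pose f (j : 'I_n.+1) : 'I_n.+1 := inord (rank w n j).
have fE j : f j = rank w n j :> nat.
  by rewrite inordK// ltnS rank_le// -ltnS.
have finj : injective f.
  move=> j k /(congr1 val); rewrite /= !fE => e.
  by apply/val_inj; apply: (rank_inj sep) e; rewrite -ltnS.
rewrite (reindex_inj finj)/=.
rewrite (eq_bigr (fun j : 'I_n.+1 => (j < unrank w n i)%N : nat)).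
  by rewrite sum_ltn// ltnW// ltnS.
by move=> j _; rewrite fE rankK// -ltnS.
Qed.

Lemma bigD1_bump n (h : nat) (f : nat -> nat) : (h <= n.+1)%N ->
  (\sum_(k < n.+2) f k = f h + \sum_(k < n.+1) f (bump h k))%N.
Proof.
move=> hn; rewrite (bigD1_ord (Ordinal (hn : (h < n.+2)%N)))//=.
Qed.

(** Inserting one term among w' increases the ranks of the larger terms by one:
    ranks evolve by the same rule as positions, with the rank of the inserted
    term in place of its position.  This is why the sorted words again form an
    erased-word process, driven by the ranks of the erased letters. *)
Lemma rank_bump w w' n h j : (h <= n.+1)%N -> (j <= n)%N ->
  (forall k, (k <= n)%N -> w' k = w (bump h k)) -> rank_separated w n.+1 ->
  rank w n.+1 (bump h j) = bump (rank w n.+1 h) (rank w' n j).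
Proof.
move=> hn jn ww' sep.
have bj : (bump h j <= n.+1)%N by rewrite /bump; case: (leqP h j); lia.
have hb : h != bump h j by rewrite neq_bump.
have rh : rank w n.+1 h = (\sum_(k < n.+1) lt (w' k) (w h))%N.
  rewrite /rank (bigD1_bump (fun k => lt (w k) (w h)) hn) lt_irr add0n.
  by apply: eq_bigr => k _; rewrite ww'// -ltnS.
have sep' : rank_separated w' n.
  move=> a b an bn ab; rewrite !ww'//; apply: sep.
  - by rewrite /bump; case: (leqP h a); lia.
  - by rewrite /bump; case: (leqP h b); lia.
  - by rewrite (inj_eq (can_inj (bumpK h))).
rewrite {1}/rank (bigD1_bump (fun k => lt (w k) (w (bump h j))) hn).
have -> : (\sum_(k < n.+1) lt (w (bump h k)) (w (bump h j)) = rank w' n j)%N.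
  by apply: eq_bigr => k _; rewrite !ww'// -ltnS.
rewrite [RHS]/bump; congr (_ + _)%N; congr nat_of_bool.
rewrite rh leqNgt -(rank_lt _ jn sep') ww'//.
have /orP[hj|jh] := sep _ _ hn bj hb; first by rewrite hj (lt_asym hj).
by rewrite jh (lt_asym jh).
Qed.

End rank.

Local Open Scope classical_set_scope.
Local Open Scope ring_scope.

(** * Events of a sigma-algebra and bounded expectations *)

(** Events are written as propositions, so that the lemmas below follow the
    logical structure of the event.  The sigma-algebra is a parameter because
    the argument uses many of them on one space. *)
Section sigma_algebra_events.
Context {T : Type} (F : set (set T)).
Hypothesis sF : sigma_algebra setT F.

Lemma sa_not (A : T -> Prop) : F [set x | A x] -> F [set x | ~ A x].
Proof. by case: sF => _ FC _ /FC; rewrite setTD. Qed.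

Lemma sa_cst (Q : Prop) : F [set _ | Q].
Proof.
case: sF => F0 FC _; have [q|nq] := pselect Q.
  by rewrite (_ : [set _ | Q] = setT `\` set0); [exact: FC|apply/seteqP; split=> x //= _; split].
by rewrite (_ : [set _ | Q] = set0)//; apply/seteqP; split.
Qed.

Lemma sa_exn (A : nat -> T -> Prop) :
  (forall i, F [set x | A i x]) -> F [set x | exists i, A i x].
Proof.
case: sF => _ _ FU /FU; congr F.
by apply/seteqP; split=> x /=; [case=> i _ Ai; exists i|case=> i Ai; exists i].
Qed.

Lemma sa_ex (I : countType) (A : I -> T -> Prop) :
  (forall i, F [set x | A i x]) -> F [set x | exists i, A i x].
Proof.
move=> FA.
rewrite (_ : [set x | _] =
    [set x | exists n, if unpickle n is Some i then A i x else False]).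
  apply: (@sa_exn (fun n x => if unpickle n is Some i then A i x else False)).
  move=> n; case: (unpickle n) => [i|]; [exact: FA|exact: sa_cst].
apply/seteqP; split=> x /= [].
  by move=> i Ai; exists (pickle i); rewrite pickleK.
by move=> n; case: (unpickle n) => [i Ai|//]; exists i.
Qed.

Lemma sa_all (I : countType) (A : I -> T -> Prop) :
  (forall i, F [set x | A i x]) -> F [set x | forall i, A i x].
Proof.
move=> FA.
rewrite (_ : [set x | _] = [set x | ~ exists i, ~ A i x]).
  by apply: sa_not; apply: sa_ex => i; apply: sa_not.
apply/seteqP; split=> x /=; first by move=> h [i]; apply.
by move=> h i; apply: contrapT => ?; apply: h; exists i.
Qed.

Lemma sa_or (A B : T -> Prop) :
  F [set x | A x] -> F [set x | B x] -> F [set x | A x \/ B x].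
Proof.
move=> FA FB; rewrite (_ : [set x | _] =
   [set x | exists b : bool, if b then A x else B x]).
  by apply: (@sa_ex bool (fun b x => if b then A x else B x)) => -[].
apply/seteqP; split=> x /=; first by case=> ?; [exists true|exists false].
by case=> -[] ?; [left|right].
Qed.

Lemma sa_and (A B : T -> Prop) :
  F [set x | A x] -> F [set x | B x] -> F [set x | A x /\ B x].
Proof.
move=> FA FB; rewrite (_ : [set x | _] =
   [set x | forall b : bool, if b then A x else B x]).
  by apply: (@sa_all bool (fun b x => if b then A x else B x)) => -[].
apply/seteqP; split=> x /=; first by case=> ? ? [].
by move=> h; split; [exact: (h true)|exact: (h false)].
Qed.

Lemma sa_imp (A B : T -> Prop) :
  F [set x | A x] -> F [set x | B x] -> F [set x | A x -> B x].
Proof.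
move=> FA FB; rewrite (_ : [set x | _] = [set x | ~ A x \/ B x]).
  by apply: sa_or => //; apply: sa_not.
apply/seteqP; split=> x /=; last by case.
by move=> h; have [/h|] := pselect (A x); [right|left].
Qed.

Lemma sa_iff (A B : T -> Prop) :
  F [set x | A x] -> F [set x | B x] -> F [set x | A x <-> B x].
Proof. by move=> FA FB; apply: sa_and; apply: sa_imp. Qed.

(** For functions with values in nat, measurability of the fibres suffices for
    every composite event or function, without a product structure. *)
Definition nat_measurable (f : T -> nat) := forall k, F [set x | f x = k].

Lemma nm_rel (Q : nat -> nat -> Prop) f g :
  nat_measurable f -> nat_measurable g -> F [set x | Q (f x) (g x)].
Proof.
move=> mf mg; rewrite (_ : [set x | _] =
  [set x | exists a, exists b, (f x = a /\ g x = b) /\ Q a b]).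
  by apply: sa_ex => a; apply: sa_ex => b; apply: sa_and (sa_cst _);
     apply: sa_and; [exact: mf|exact: mg].
apply/seteqP; split=> x /=; first by move=> h; exists (f x), (g x).
by move=> [a [b [[-> ->]]]].
Qed.

Lemma nm_pred (Q : nat -> Prop) f : nat_measurable f -> F [set x | Q (f x)].
Proof. by move=> mf; exact: (@nm_rel (fun a _ => Q a) _ _ mf mf). Qed.

Lemma nm_op2 (o : nat -> nat -> nat) f g :
  nat_measurable f -> nat_measurable g ->
  nat_measurable (fun x => o (f x) (g x)).
Proof. by move=> mf mg k; exact: (@nm_rel (fun a b => o a b = k)). Qed.

Lemma nm_op (o : nat -> nat) f :
  nat_measurable f -> nat_measurable (fun x => o (f x)).
Proof. by move=> mf k; exact: (@nm_pred (fun a => o a = k)). Qed.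

Lemma nm_cst c : nat_measurable (fun=> c).
Proof. by move=> k; exact: sa_cst. Qed.

Lemma nm_bool (b : T -> bool) : F [set x | b x] -> nat_measurable (fun x => b x).
Proof.
move=> Fb [|[|k]].
- rewrite (_ : [set x | _] = [set x | ~ b x]); first exact: sa_not.
  by apply/seteqP; split=> x /=; case: (b x) => // /(_ isT).
- rewrite (_ : [set x | _] = [set x | b x])//.
  by apply/seteqP; split=> x /=; case: (b x).
- rewrite (_ : [set x | _] = [set _ | False]); first exact: sa_cst.
  by apply/seteqP; split=> x /=; case: (b x).
Qed.

Lemma nm_sum n (f : nat -> T -> nat) : (forall i, (i < n)%N -> nat_measurable (f i)) ->
  nat_measurable (fun x => \sum_(i < n) f i x)%N.
Proof.
elim: n => [|n IH] mf.
  rewrite (_ : (fun x => _) = fun=> 0%N); first exact: nm_cst.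
  by apply/funext => x; rewrite big_ord0.
rewrite (_ : (fun x => _) = fun x => (\sum_(i < n) f i x + f n x)%N).
  apply: nm_op2; last exact: mf.
  by apply: IH => i /ltnW; exact: mf.
by apply/funext => x; rewrite big_ord_recr.
Qed.

Lemma nm_pick (g : T -> nat) (A : nat -> T -> Prop) : nat_measurable g ->
  (forall k, F [set x | A k x]) -> F [set x | A (g x) x].
Proof.
move=> mg mA; rewrite (_ : [set x | _] = [set x | exists k, g x = k /\ A k x]).
  by apply: sa_ex => k; apply: sa_and; [exact: mg|exact: mA].
by apply/seteqP; split=> x /=; [move=> h; exists (g x)|move=> [k [->]]].
Qed.

Lemma nm_pickf (g : T -> nat) (f : nat -> T -> nat) : nat_measurable g ->
  (forall k, nat_measurable (f k)) -> nat_measurable (fun x => f (g x) x).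
Proof. by move=> mg mf k; apply: (@nm_pick g (fun j x => f j x = k)) => // j; exact: mf. Qed.

End sigma_algebra_events.

Section prob.
Context {R : realType} {d} {T : measurableType d} (P : probability T R).

Lemma sa_measurable : sigma_algebra setT (@measurable _ T).
Proof. exact: sigma_algebra_measurable. Qed.

(** Probabilities and expectations of bounded functions are taken in the real
    field, where linear arithmetic applies. *)
Definition pr (A : set T) : R := fine (P A).

Lemma prE A : measurable A -> P A = (pr A)%:E.
Proof. by move=> mA; rewrite /pr fineK// fin_num_measure. Qed.

Lemma pr_ge0 A : 0 <= pr A.
Proof. by rewrite /pr fine_ge0. Qed.

Lemma prT : pr setT = 1.
Proof. by rewrite /pr probability_setT. Qed.

Lemma pr0 : pr set0 = 0.
Proof. by rewrite /pr measure0. Qed.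

Lemma pr_le A B : measurable A -> measurable B -> A `<=` B -> pr A <= pr B.
Proof.
by move=> mA mB AB; rewrite -lee_fin -!prE// le_measure// inE.
Qed.

Lemma pr_le1 A : measurable A -> pr A <= 1.
Proof. by move=> mA; rewrite -prT pr_le. Qed.

Lemma pr_U A B : measurable A -> measurable B -> pr (A `|` B) <= pr A + pr B.
Proof.
move=> mA mB; rewrite -lee_fin EFinD -!prE//; last exact: measurableU.
exact: probability_setU_le || exact: measureU2.
Qed.

Definition bounded_mfun (f : T -> R) :=
  measurable_fun setT f /\ exists K, forall x, `|f x| <= K.

Definition Ex (f : T -> R) : R := Rintegral P setT f.

Lemma bounded_mfun_int f : bounded_mfun f -> P.-integrable setT (EFin \o f).
Proof.
move=> [mf [K fK]]; apply: measurable_bounded_integrable => //.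
  by rewrite ltey_eq fin_num_measure.
exists K; split; first exact: num_real.
by move=> y Ky x _; exact: (le_trans (fK x) (ltW Ky)).
Qed.

Lemma bounded_mfunD f g : bounded_mfun f -> bounded_mfun g -> bounded_mfun (fun x => f x + g x).
Proof.
move=> [mf [K fK]] [mg [L gL]]; split; first exact: measurable_funD.
by exists (K + L) => x; rewrite (le_trans (ler_normD _ _))// lerD.
Qed.

Lemma bounded_mfunM f g : bounded_mfun f -> bounded_mfun g -> bounded_mfun (fun x => f x * g x).
Proof.
move=> [mf [K fK]] [mg [L gL]]; split; first exact: measurable_funM.
by exists (K * L) => x; rewrite normrM ler_pM.
Qed.

Lemma bounded_mfun_cst c : bounded_mfun (fun=> c).
Proof. by split; [exact: measurable_cst|exists `|c|]. Qed.

Lemma bounded_mfunZ c f : bounded_mfun f -> bounded_mfun (fun x => c * f x).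
Proof. by move=> bf; apply: bounded_mfunM => //; exact: bounded_mfun_cst. Qed.

Lemma bounded_mfunN f : bounded_mfun f -> bounded_mfun (fun x => - f x).
Proof.
move=> /(bounded_mfunZ (-1)); rewrite (_ : (fun x => _) = fun x => - f x)//.
by apply/funext => x; rewrite mulN1r.
Qed.

Lemma bounded_mfunB f g : bounded_mfun f -> bounded_mfun g -> bounded_mfun (fun x => f x - g x).
Proof. by move=> bf /bounded_mfunN; exact: bounded_mfunD. Qed.

Lemma bounded_mfun_sum n (f : nat -> T -> R) : (forall i, (i < n)%N -> bounded_mfun (f i)) ->
  bounded_mfun (fun x => \sum_(i < n) f i x).
Proof.
elim: n => [|n IH] mf.
  rewrite (_ : (fun x => _) = fun=> 0); first exact: bounded_mfun_cst.
  by apply/funext => x; rewrite big_ord0.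
rewrite (_ : (fun x => _) = fun x => \sum_(i < n) f i x + f n x).
  apply: bounded_mfunD; last exact: mf.
  by apply: IH => i /ltnW; exact: mf.
by apply/funext => x; rewrite big_ord_recr.
Qed.

Lemma bounded_mfun_norm f : bounded_mfun f -> bounded_mfun (fun x => `|f x|).
Proof.
move=> [mf [K fK]]; split; first exact: measurableT_comp.
by exists K => x; rewrite normr_id.
Qed.

Lemma ExD f g : bounded_mfun f -> bounded_mfun g -> Ex (fun x => f x + g x) = Ex f + Ex g.
Proof. by move=> /bounded_mfun_int bf /bounded_mfun_int bg; rewrite /Ex RintegralD. Qed.

Lemma ExB f g : bounded_mfun f -> bounded_mfun g -> Ex (fun x => f x - g x) = Ex f - Ex g.
Proof. by move=> /bounded_mfun_int bf /bounded_mfun_int bg; rewrite /Ex RintegralB. Qed.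

Lemma ExZ c f : bounded_mfun f -> Ex (fun x => c * f x) = c * Ex f.
Proof. by move=> /bounded_mfun_int bf; rewrite /Ex RintegralZl. Qed.

Lemma Ex_cst c : Ex (fun=> c) = c.
Proof. rewrite /Ex Rintegral_cst//. by rewrite -/(pr setT) prT mulr1. Qed.

Lemma Ex_le f g : bounded_mfun f -> bounded_mfun g -> (forall x, f x <= g x) -> Ex f <= Ex g.
Proof. by move=> /bounded_mfun_int bf /bounded_mfun_int bg h; exact: le_Rintegral. Qed.

Lemma Ex_sum n (f : nat -> T -> R) : (forall i, (i < n)%N -> bounded_mfun (f i)) ->
  Ex (fun x => \sum_(i < n) f i x) = \sum_(i < n) Ex (f i).
Proof.
elim: n => [|n IH] mf.
  rewrite big_ord0 -[RHS](Ex_cst 0); congr Ex.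
  by apply/funext => x; rewrite big_ord0.
rewrite big_ord_recr/= -IH; last by move=> i /ltnW; exact: mf.
rewrite -ExD; [|by apply: bounded_mfun_sum => i /ltnW; exact: mf|exact: mf].
by congr Ex; apply/funext => x; rewrite big_ord_recr.
Qed.

Lemma bounded_mfun_bool (b : T -> bool) : measurable [set x | b x] ->
  bounded_mfun (fun x => (b x)%:R).
Proof.
move=> mb; rewrite (_ : (fun x => _) = \1_[set x | b x]).
  split; first exact: measurable_indic.
  by exists 1 => x; rewrite indicE; case: (_ \in _); rewrite ?normr1 ?normr0.
apply/funext => x; rewrite indicE; congr (nat_of_bool _)%:R.
by apply/idP/idP; rewrite inE.
Qed.

Lemma Ex_bool (b : T -> bool) : measurable [set x | b x] ->
  Ex (fun x => (b x)%:R) = pr [set x | b x].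
Proof.
move=> mb; rewrite (_ : (fun x => _) = \1_[set x | b x]).
  rewrite /Ex /Rintegral (_ : (fun x => (_)%:E) = EFin \o \1_[set x | b x])//.
  by rewrite integral_indic// setIT.
apply/funext => x; rewrite indicE; congr (nat_of_bool _)%:R.
by apply/idP/idP; rewrite inE.
Qed.

Lemma bounded_mfun_nat (f : T -> nat) K : nat_measurable measurable f ->
  (forall x, (f x <= K)%N) -> bounded_mfun (fun x => (f x)%:R).
Proof.
move=> mf fK.
rewrite (_ : (fun x => _) = fun x => \sum_(i < K) (i < f x)%N%:R).
  apply: (@bounded_mfun_sum K (fun i x => (i < f x)%N%:R)) => i _; apply: bounded_mfun_bool.
  exact: (@nm_pred _ _ sa_measurable (fun a => (i < a)%N)).
by apply/funext => x; rewrite -natr_sum sum_ltn.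
Qed.

End prob.

(** * Completed sigma-algebras and almost sure convergence *)

Section completion.
Context {R : realType} {d} {T : measurableType d} (P : probability T R).

(** The completion of G by the null sets that are measurable for P: all almost
    sure identifications are absorbed by passing to it. *)
Definition completion (G : set (set T)) : set (set T) :=
  [set B | measurable B /\ exists2 C, G C & P (B `+` C) = 0%E].

Lemma symdiff0_ae (A B : set T) : measurable A -> measurable B ->
  P (A `+` B) = 0%E <-> {ae P, forall x, A x <-> B x}.
Proof.
move=> mA mB; have mAB : measurable (A `+` B) by apply: measurableU; exact: measurableD.
rewrite -(negligibleP _ mAB) /almost_everywhere; split; apply: negligibleS => x /=.
  rewrite /setY/= => h; have [a|na] := pselect (A x); have [b|nb] := pselect (B x).
  - by case: h.
  - by left.
  - by right.
  - by case: h.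
by case=> -[a b] [ab ba]; [apply: b; apply: ab|apply: b; apply: ba].
Qed.

Variable G : set (set T).
Hypotheses (sG : sigma_algebra setT G) (Gm : G `<=` measurable).

Lemma completionP (B : set T) : completion G B <->
  measurable B /\ exists2 C, G C & {ae P, forall x, B x <-> C x}.
Proof.
split=> -[mB [C GC h]]; split => //; exists C => //.
  by apply/symdiff0_ae => //; exact: Gm.
by apply/symdiff0_ae => //; exact: Gm.
Qed.

Lemma sub_completion : G `<=` completion G.
Proof. by move=> B GB; apply/completionP; split; [exact: Gm|exists B => //; exact: aeW]. Qed.

Lemma completion_sigma : sigma_algebra setT (completion G).
Proof.
split.
- by apply: sub_completion; case: sG.
- move=> A /completionP[mA [C GC h]]; apply/completionP; split; first exact: measurableD.
  exists (setT `\` C); first by case: sG => _ GD _; exact: GD.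
  apply: filterS h => x h; rewrite !setTD /=; split; apply: contra_not; exact: h.2 || exact: h.1.
- move=> A cA.
  have /choice[C hC] : forall n, exists C, G C /\ {ae P, forall x, A n x <-> C x}.
    by move=> n; have /completionP[_ [C GC h]] := cA n; exists C.
  apply/completionP; split.
    by apply: bigcup_measurable => n _; have [] := cA n.
  exists (\bigcup_n C n); first by case: sG => _ _; apply => n; case: (hC n).
  have : {ae P, forall x, forall n, A n x <-> C n x}.
    by apply: ae_foralln => n; case: (hC n).
  by apply: filterS => x h; split=> -[n _ /h]; exists n.
Qed.

Lemma completion_ae (B B' : set T) : completion G B -> measurable B' ->
  {ae P, forall x, B x <-> B' x} -> completion G B'.
Proof.
move=> /completionP[mB [C GC h]] mB' h'; apply/completionP; split => //.
by exists C => //; apply: filterS2 h h' => x [? ?] [? ?]; tauto.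
Qed.

Lemma completion_full (B : set T) : measurable B -> {ae P, forall x, B x} -> completion G B.
Proof.
move=> mB h; apply: (@completion_ae [set _ | True]) => //.
  by apply: sub_completion; exact: (sa_cst sG).
by apply: filterS h.
Qed.

(** The completion is closed for convergence in probability of events: if C_k
    approximates B up to probability 2^-k, then by Borel-Cantelli B is almost
    surely the limsup of the C_k. *)
Lemma completion_approx (B : set T) : measurable B ->
  (forall k : nat, exists C, G C /\ pr P (B `+` C) <= 2^-1 ^+ k.+1) -> completion G B.
Proof.
move=> mB /choice[C hC]; apply/completionP; split => //.
have mC k : measurable (C k) by apply: Gm; case: (hC k).
have mBC k : measurable (B `+` C k) by apply: measurableU; exact: measurableD.
have L0 : P (lim_sup_set (fun k => B `+` C k)) = 0%E.
  apply: lim_sup_set_cvg0 => //.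
  apply: (@le_lt_trans _ _ (1%:E)); last by rewrite ltry.
  apply: le_trans (@epsilon_trick0 R 1 xpredT ler01).
  apply: lee_nneseries => // k _; rewrite /= (prE P (mBC k)) lee_fin.
  by case: (hC k) => _; rewrite exprVn natrX mul1r.
exists [set x | forall n, exists k, (n <= k)%N /\ C k x].
  apply: (sa_all sG) => n; apply: (sa_ex sG) => k; apply: (sa_and sG) (sa_cst sG _) _.
  by case: (hC k).
have : {ae P, forall x, ~ lim_sup_set (fun k => B `+` C k) x}.
  apply/(negligibleS _ (proj2 (negligibleP P _) L0)).
    by move=> x /= /contrapT.
  by apply: bigcap_measurable => // n _; exact: bigcup_measurable.
apply: filterS => x; rewrite /lim_sup_set /= => h; split.
  move=> Bx n; apply: contrapT => hn; apply: h => m _.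
  exists (maxn n m) => /=; first exact: leq_maxr.
  left; split => // Cx; apply: hn; exists (maxn n m); split => //; exact: leq_maxl.
move=> hx; apply: contrapT => nB; apply: h => m _.
by have [k [mk Cx]] := hx m; exists k => //; right.
Qed.

End completion.

Lemma pr_ae (R : realType) d (T : measurableType d) (P : probability T R) (A B : set T) :
  measurable A -> measurable B -> {ae P, forall x, A x <-> B x} -> pr P A = pr P B.
Proof.
have main A' B' : measurable A' -> measurable B' -> {ae P, forall x, A' x <-> B' x} ->
    pr P A' <= pr P B'.
  move=> mA mB /(proj2 (symdiff0_ae P mA mB)) h.
  have mAB : measurable (A' `+` B') by apply: measurableU; exact: measurableD.
  have -> : pr P B' = pr P B' + pr P (A' `+` B') by rewrite [X in _ + X]/pr h addr0.
  apply: le_trans (pr_U P mB mAB); apply: pr_le => //; first exact: measurableU.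
  by move=> x Ax; have [Bx|nB] := pselect (B' x); [left|right; left].
move=> mA mB h; apply/eqP; rewrite eq_le !main//.
by apply: filterS h => x [? ?].
Qed.

Section prob_tools.
Context {R : realType} {d} {T : measurableType d} (P : probability T R).
Local Notation pr := (pr P).
Local Notation Ex := (Ex P).

(** Almost sure convergence implies convergence in probability. *)
Lemma ae_eventually_pr (A : nat -> set T) (e : R) : (forall k, measurable (A k)) ->
  {ae P, forall x, exists n, forall k, (n <= k)%N -> ~ A k x} -> 0 < e ->
  exists n, forall k, (n <= k)%N -> pr (A k) <= e.
Proof.
move=> mA h e0.
have mU n : measurable (\bigcup_(k >= n) A k) by exact: bigcup_measurable.
have L0 : P (lim_sup_set A) = 0%E.
  apply/negligibleP; first by apply: bigcap_measurable.
  apply: negligibleS h => x /= hx [n hn].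
  by have [k /= nk] := hx n I; exact: hn.
have fU : (P (\bigcup_(k >= 0%N) A k) < +oo)%E.
  by rewrite (prE P (mU 0%N)) ltry.
have := lim_sup_set_cvg P A mA fU; rewrite [X in _ --> X]L0.
move=> /fine_cvgP[_ /cvgrPdist_le /(_ _ e0)[n _ hn]].
exists n => k nk; have := hn n (leqnn n); rewrite /= sub0r normrN => h1.
apply: le_trans (le_trans (ler_norm _) h1).
by apply: pr_le => // x Ax; exists k.
Qed.

(** If X is uniform on {0, ..., K} and independent of the family Z, then
    Z_X has the mean of the average of the Z_c.  Independence is expressed
    through the events {a < Z_c}, so that the lemma serves both for the future
    and for the past of a mark. *)
Lemma unif_sum (X : T -> nat) K (Z : nat -> T -> nat) L :
  (forall x, (X x <= K)%N) -> (forall c x, (Z c x <= L)%N) ->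
  nat_measurable measurable X -> (forall c, nat_measurable measurable (Z c)) ->
  (forall c a, (c <= K)%N ->
     pr [set x | X x = c /\ (a < Z c x)%N] = pr [set x | (a < Z c x)%N] / K.+1%:R) ->
  Ex (fun x => (Z (X x) x)%:R) = Ex (fun x => (\sum_(c < K.+1) Z c x)%N%:R) / K.+1%:R.
Proof.
move=> XK ZL mX mZ h.
have mZa c a : measurable [set x | (a < Z c x)%N].
  exact: (nm_pred sa_measurable (fun n => (a < n)%N : Prop) (mZ c)).
have mXZ c a : measurable [set x | (X x == c) && (a < Z c x)%N].
  rewrite (_ : [set x | _] = [set x | X x = c /\ (a < Z c x)%N]).
    by apply: (sa_and sa_measurable) => //; exact: mX.
  by apply/seteqP; split=> x /=; [move=> /andP[/eqP]|move=> [/eqP ->]].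
have -> : (fun x => (Z (X x) x)%:R : R) = fun x => \sum_(c < K.+1) \sum_(a < L)
    ((X x == c) && (a < Z c x)%N)%:R.
  apply/funext => x; rewrite (bigD1 (Ordinal (XK x : (X x < K.+1)%N)))//= [X in _ + X]big1 ?addr0.
    by rewrite eqxx/= -natr_sum sum_ltn.
  by move=> i; rewrite -val_eqE/= eq_sym => /negbTE ->; rewrite big1.
have -> : (fun x => (\sum_(c < K.+1) Z c x)%N%:R : R) = fun x => \sum_(c < K.+1) \sum_(a < L)
    (a < Z c x)%N%:R.
  apply/funext => x; rewrite natr_sum; apply: eq_bigr => c _.
  by rewrite -natr_sum sum_ltn.
rewrite (@Ex_sum _ _ _ _ _ (fun c x => \sum_(a < L) ((X x == c) && (a < Z c x)%N)%:R)); last first.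
  move=> c _; apply: (bounded_mfun_sum (f := fun a x => ((X x == c) && (a < Z c x)%N)%:R)) => a _.
  exact: bounded_mfun_bool.
rewrite (@Ex_sum _ _ _ _ _ (fun c x => \sum_(a < L) (a < Z c x)%N%:R)); last first.
  move=> c _; apply: (bounded_mfun_sum (f := fun a x => (a < Z c x)%N%:R)) => a _.
  exact: bounded_mfun_bool.
rewrite mulr_suml; apply: eq_bigr => c _.
rewrite (@Ex_sum _ _ _ _ _ (fun a x => ((X x == c) && (a < Z c x)%N)%:R)); last first.
  by move=> a _; exact: bounded_mfun_bool.
rewrite (@Ex_sum _ _ _ _ _ (fun a x => (a < Z c x)%N%:R)); last first.
  by move=> a _; exact: bounded_mfun_bool.
rewrite mulr_suml; apply: eq_bigr => a _.
rewrite (Ex_bool P (b := fun x => (X x == c) && (a < Z c x)%N))// Ex_bool// -h; last first.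
  by rewrite -ltnS.
by congr pr; apply/seteqP; split=> x /=; [move=> /andP[/eqP]|move=> [/eqP ->]].
Qed.

(** Orthogonal increments of size at most 1/(k+2) make the squared L2 distance
    between the terms M and M + m at most 1/(M+1), so the increments along the
    times 4^k are summable in L1.  Forward and reversed martingales with such
    increments are both covered.  The times 4^k are kept explicit because one
    sequence of times has to serve for all letters. *)
Lemma orth_increments_cvg (X : nat -> T -> R) (n0 : nat) :
  (forall k, bounded_mfun (X k)) ->
  (forall k x, (n0 <= k)%N -> `|X k.+1 x - X k x| <= k.+2%:R^-1) ->
  (forall k l, (n0 <= k)%N -> (k < l)%N ->
     Ex (fun x => (X k.+1 x - X k x) * (X l.+1 x - X l x)) = 0) ->
  {ae P, forall x, cvgn (fun k => X (4 ^ k)%N x)}.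
Proof.
move=> bX inc orth.
pose D k x := X k.+1 x - X k x.
have bD k : bounded_mfun (D k) by exact: bounded_mfunB.
have tele M m x : X (M + m)%N x - X M x = \sum_(i < m) D (M + i)%N x.
  elim: m => [|m IH]; first by rewrite addn0 subrr big_ord0.
  by rewrite big_ord_recr/= -IH /D addnS; ring.
have E2 M m : (n0 <= M)%N ->
    Ex (fun x => (X (M + m)%N x - X M x) ^+ 2) <= M.+1%:R^-1 - (M + m).+1%:R^-1.
  move=> nM; elim: m => [|m IH].
    rewrite addn0 subrr (_ : (fun x => _) = fun=> 0) ?Ex_cst//.
    by apply/funext => x; rewrite subrr expr0n.
  pose Y x := X (M + m)%N x - X M x.
  have bY : bounded_mfun Y by exact: bounded_mfunB.
  (* Expanding the square: the cross term vanishes by orthogonality. *)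
  have -> : (fun x => (X (M + m.+1)%N x - X M x) ^+ 2) =
      fun x => Y x ^+ 2 + (2 * (Y x * D (M + m)%N x) + D (M + m)%N x ^+ 2).
    by apply/funext => x; rewrite /Y /D addnS; ring.
  have bD2 : bounded_mfun (fun x => D (M + m)%N x ^+ 2) by exact: bounded_mfunM.
  have bYD : bounded_mfun (fun x => Y x * D (M + m)%N x) by exact: bounded_mfunM.
  have bY2 : bounded_mfun (fun x => Y x ^+ 2) by exact: bounded_mfunM.
  rewrite ExD//; last by apply: bounded_mfunD => //; exact: bounded_mfunZ.
  rewrite ExD//; last exact: bounded_mfunZ.
  rewrite ExZ//.
  have -> : Ex (fun x => Y x * D (M + m)%N x) = 0.
    have -> : (fun x => Y x * D (M + m)%N x) =
       fun x => \sum_(i < m) (D (M + i)%N x * D (M + m)%N x).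
      by apply/funext => x; rewrite /Y tele mulr_suml.
    rewrite (@Ex_sum _ _ _ _ _ (fun i x => D (M + i)%N x * D (M + m)%N x)); last first.
      by move=> i _; exact: bounded_mfunM.
    rewrite big1// => i _; apply: orth; first by rewrite (leq_trans nM)// leq_addr.
    by rewrite ltn_add2l.
  have hD : Ex (fun x => D (M + m)%N x ^+ 2) <= (M + m).+1%:R^-1 - (M + m).+2%:R^-1.
    apply: (@le_trans _ _ ((M + m).+2%:R^-1 ^+ 2)).
      rewrite -[leRHS](Ex_cst P); apply: Ex_le => //; first exact: bounded_mfun_cst.
      move=> x; rewrite -real_normK ?num_real// lerXn2r ?nnegrE//.
      by apply: inc; rewrite (leq_trans nM)// leq_addr.
    rewrite -[(M + m).+2%:R]natr1; set a : R := (M + m).+1%:R.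
    have a0 : 0 < a by rewrite ltr0n.
    have -> : a^-1 - (a + 1)^-1 = (a * (a + 1))^-1.
      by field; apply/andP; split; lra.
    by rewrite expr2 -invfM lef_pV2 ?posrE; nra.
  rewrite mulr0 add0r addnS.
  by rewrite (le_trans (lerD IH hD))// addrA subrK.
pose k0 := n0.
pose del k x := X (4 ^ (k0 + k).+1)%N x - X (4 ^ (k0 + k))%N x.
have bdel k : bounded_mfun (del k) by exact: bounded_mfunB.
have Edel k : Ex (fun x => `|del k x|) <= 2^-1 ^+ k.
  set q := (k0 + k)%N.
  have n0q : (n0 <= 4 ^ q)%N.
    by rewrite (leq_trans _ (ltnW (ltn_expl q _)))// /q leq_addr.
  have e : (4 ^ q.+1 = 4 ^ q + 3 * 4 ^ q)%N by rewrite expnS; lia.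
  have h := E2 (4 ^ q)%N (3 * 4 ^ q)%N n0q.
  have h2 : Ex (fun x => del k x ^+ 2) <= (2^-1 ^+ q) ^+ 2.
    rewrite /del -/q e; apply: (le_trans h).
    apply: (@le_trans _ _ (4 ^ q).+1%:R^-1); first by rewrite lerBlDr lerDl invr_ge0.
    rewrite -exprM mulnC exprM (_ : 2^-1 ^+ 2 = 4^-1 :> R); last by rewrite expr2; lra.
    rewrite exprVn lef_pV2 ?posrE ?ltr0n ?exprn_gt0//.
    by rewrite -natrX ler_nat.
  have b2 : bounded_mfun (fun x => del k x ^+ 2) by exact: bounded_mfunM.
  set t : R := 2^-1 ^+ q in h2 *.
  have t0 : 0 < t by rewrite exprn_gt0.
  have tn0 : t != 0 by rewrite gt_eqF.
  apply: (@le_trans _ _ t); last first.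
    by rewrite /t /q exprD ler_piMl ?exprn_ge0// exprn_ile1//; lra.
  (* |u| <= u^2 / (2 t) + t / 2, with t = 2^-q the bound on the L2 norm. *)
  have -> : t = Ex (fun x => (2 * t)^-1 * (del k x ^+ 2) + t / 2) +
       (t / 2 - (2 * t)^-1 * Ex (fun x => del k x ^+ 2)).
    by rewrite ExD ?Ex_cst ?ExZ//; [lra|exact: bounded_mfunZ|exact: bounded_mfun_cst].
  apply: (@le_trans _ _ (Ex (fun x => (2 * t)^-1 * (del k x ^+ 2) + t / 2))).
    apply: Ex_le.
    - exact: bounded_mfun_norm.
    - by apply: bounded_mfunD; [exact: bounded_mfunZ|exact: bounded_mfun_cst].
    - move=> x; rewrite -[del k x ^+ 2]real_normK ?num_real//; move: (`|del k x| : R) => u.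
      have -> : (2 * t)^-1 * u ^+ 2 + t / 2 = u + (2 * t)^-1 * (u - t) ^+ 2.
        by field.
      by rewrite lerDl mulr_ge0 ?sqr_ge0// invr_ge0; lra.
  rewrite lerDl subr_ge0.
  rewrite (_ : t / 2 = (2 * t)^-1 * t ^+ 2); last by field.
  by rewrite ler_pM2l// invr_gt0; lra.
have mnd k : measurable_fun setT (fun x => `|del k x|%:E).
  by apply/measurable_EFinP; case: (bounded_mfun_norm (bdel k)).
have fin : (\int[P]_x (\sum_(k <oo) `|del k x|%:E) < +oo)%E.
  rewrite (integral_nneseries _ measurableT (f := fun k x => `|del k x|%:E))//.
  apply: (@le_lt_trans _ _ (2%:E)); last by rewrite ltry.
  apply: le_trans (@epsilon_trick0 R 2 xpredT _); last by lra.
  apply: lee_nneseries => // [k _ _|k _]; first exact: integral_ge0.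
  have -> : (\int[P]_x `|del k x|%:E = (Ex (fun x => `|del k x|))%:E)%E.
    rewrite /Ex /Rintegral fineK//.
    exact: (integrable_fin_num (f := EFin \o _) measurableT (bounded_mfun_int P (bounded_mfun_norm (bdel k)))).
  rewrite lee_fin (le_trans (Edel k))//.
  rewrite expnS natrM natrX exprVn.
  by rewrite (_ : 2 / (2 * 2 ^+ k) = (2 ^+ k)^-1 :> R)//; field; exact: expf_neq0.
have intS : P.-integrable setT (fun x => \sum_(k <oo) `|del k x|%:E)%E.
  apply/integrableP; split.
    by apply: (@ge0_emeasurable_sum _ _ _ setT (fun k x => `|del k x|%:E) xpredT).
  rewrite (eq_integral (fun x => \sum_(k <oo) `|del k x|%:E)%E)// => x _.
  by rewrite gee0_abs// nneseries_ge0.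
have := integrable_ae measurableT intS; apply: filterS => x /(_ I) xfin.
have cn : cvgn [normed series (fun k => del k x)].
  apply: nondecreasing_is_cvgn.
    by apply: nondecreasing_series => k _ _; exact: normr_ge0.
  exists (fine (\sum_(k <oo) `|del k x|%:E)%E) => _ [n _ <-].
  rewrite -lee_fin fineK// /series/= -sumEFin.
  exact: nneseries_lim_ge.
have /cvg_ex[l hl] := normed_cvg cn.
apply/cvg_ex; exists (l + X (4 ^ k0)%N x).
rewrite -(cvg_shiftn k0).
rewrite (_ : (fun n => _) = (fun n => series (fun k => del k x) n + X (4 ^ k0)%N x)).
  by apply: cvgD => //; exact: cvg_cst.
apply/funext => n /=; elim: n => [|n IH].
  by rewrite add0n /series/= big_geq// add0r.
rewrite /series/= big_nat_recr//= -/(series (fun k => del k x) n) addrAC -IH.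
by rewrite /del addSn addnC; ring.
Qed.

End prob_tools.

(** * Positions of letters under uniform insertions *)

Section cutpos.
Context {T : Type} (h : nat -> T -> nat).

(** The place, in the word of index n + m, of a cut a of the word of index n,
    when the word of index k + 1 arises from that of index k by inserting a
    letter at the place h (k + 1).  A cut a stands between the letters a - 1
    and a, so that the letter j of the word (counted from 0) sits just before
    the cut j + 1.  Using cuts, the left end 0 is a fixed cut and the position
    of a letter is a distance of two cuts.  The recursion unfolds at the small
    end, which makes the passage from the word n to the word n + 1
    definitional; [cutS] unfolds it at the other end. *)
Fixpoint cutpos (n m a : nat) (x : T) : nat :=
  if m is m'.+1 then cutpos n.+1 m' (a + (h n.+1 x < a))%N x else a.

(** Events depending on the marks of times n + 1, ..., N only. *)
Definition past (n N : nat) (C : set T) :=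
  forall x y, (forall k, (n < k <= N)%N -> h k x = h k y) -> C x -> C y.

Definition past_fun (n N : nat) (U : Type) (f : T -> U) :=
  forall x y, (forall k, (n < k <= N)%N -> h k x = h k y) -> f x = f y.

Lemma cutS n m a x :
  cutpos n m.+1 a x = (cutpos n m a x + (h (n + m).+1 x < cutpos n m a x))%N.
Proof.
elim: m n a => [|m IH] n a; first by rewrite /= addn0.
by rewrite [LHS]/= -[LHS]/(cutpos n.+1 m.+1 _ x) IH addSnnS.
Qed.

Lemma cut0 n m x : cutpos n m 0 x = 0%N.
Proof. by elim: m n => //= m IH n. Qed.

Lemma cut_le n m a x : (a <= n.+1)%N -> (cutpos n m a x <= (n + m).+1)%N.
Proof.
move=> an; elim: m => [|m IH]; first by rewrite addn0.
by rewrite cutS addnS; case: (_ < _)%N; lia.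
Qed.

Lemma cut_lt n m a b x : (a < b)%N -> (cutpos n m a x < cutpos n m b x)%N.
Proof.
move=> ab; elim: m => [//|m IH]; rewrite !cutS.
by case: (ltnP _ (cutpos n m a x)) => h1; case: (ltnP _ (cutpos n m b x)) => h2; lia.
Qed.

Lemma cut_past n m a : past_fun n (n + m) (cutpos n m a).
Proof.
move=> x y hxy; elim: m hxy => [//|m IH] hxy; rewrite !cutS IH ?hxy//.
  by apply/andP; split; lia.
by move=> k /andP[? ?]; apply: hxy; apply/andP; split; lia.
Qed.

Lemma past_funW n N N' U (f : T -> U) : (N <= N')%N -> past_fun n N f -> past_fun n N' f.
Proof.
move=> NN' pf x y hxy; apply: pf => k /andP[nk kN]; apply: hxy.
by rewrite nk (leq_trans kN).
Qed.

Lemma past_fun_past n N U (f : T -> U) (Q : U -> Prop) : past_fun n N f ->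
  past n N [set x | Q (f x)].
Proof. by move=> pf x y hxy /=; rewrite (pf x y hxy). Qed.

(** Freezing the last mark at c turns an event of the past up to n + m + 1 into
    one of the past up to n + m: the section is taken over the range of the
    process rather than over all sequences of marks. *)
Lemma past_step n m (C : set T) : past n (n + m).+1 C ->
  exists D : nat -> set T, [/\ forall c, past n (n + m) (D c) &
    forall x, C x <-> D (h (n + m).+1 x) x].
Proof.
move=> pC; exists (fun c => [set x | exists y, [/\ C y, h (n + m).+1 y = c &
   forall k, (n < k <= n + m)%N -> h k x = h k y]]); split.
  move=> c x y hxy /= [z [Cz hz hk]]; exists z; split => // k kn.
  by rewrite -hxy// hk.
move=> x; split => [Cx|/= [y [Cy hy hk]]]; first by exists x.
apply: (pC y x) => // k /andP[nk]; rewrite leq_eqVlt => /predU1P[->//|kn].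
by rewrite hk// nk.
Qed.

Lemma past_measurable (G : set (set T)) n m : sigma_algebra setT G ->
  (forall k, (n < k <= n + m)%N -> nat_measurable G (h k)) ->
  forall C, past n (n + m) C -> G C.
Proof.
move=> sG; elim: m => [|m IH] mh C pC.
  rewrite (_ : C = [set x | exists y, C y]); first exact: sa_cst.
  apply/seteqP; split=> x /=; first by exists x.
  by move=> [y Cy]; apply: (pC y x) => // k; lia.
have [D [pD hD]] : exists D : nat -> set T, [/\ forall c, past n (n + m) (D c) &
    forall x, C x <-> D (h (n + m).+1 x) x].
  by apply: past_step; rewrite -addnS.
rewrite (_ : C = [set x | D (h (n + m).+1 x) x]).
  apply: (@nm_pick _ _ sG (h (n + m).+1) D); first by apply: (mh (n + m).+1); lia.
  by move=> c; apply: (IH _ (D c)) => // k ?; apply: (mh k); lia.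
by apply/seteqP; split => x /hD.
Qed.

End cutpos.

Section innovation.
Context {R : realType} {d} {T : measurableType d} (P : probability T R).
Local Notation pr := (pr P).
Local Notation Ex := (Ex P).

Lemma pr_partition (X : T -> nat) K A : (forall x, (X x <= K)%N) ->
  nat_measurable measurable X -> measurable A ->
  pr A = \sum_(c < K.+1) pr ([set x | X x = c] `&` A).
Proof.
move=> XK mX mA.
have mb c : measurable [set x | `[< X x = c /\ A x >]].
  rewrite (_ : [set x | _] = [set x | X x = c] `&` A).
    by apply: measurableI => //; exact: mX.
  by apply/seteqP; split=> x /=; [move/asboolP|move=> ?; apply/asboolP].
have mA' : measurable [set x | `[< A x >]].
  by rewrite (_ : [set x | _] = A)//; apply/seteqP; split=> x /=; move/asboolP.
transitivity (pr [set x | `[< A x >]]).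
  by congr pr; apply/seteqP; split=> x /=; [move=> ?; apply/asboolP|move/asboolP].
rewrite -Ex_bool// (_ : (fun x => _) = fun x => \sum_(c < K.+1) `[< X x = c /\ A x >]%:R).
  rewrite (@Ex_sum _ _ _ _ _ (fun c x => `[< X x = c /\ A x >]%:R)); last first.
    by move=> c _; exact: bounded_mfun_bool.
  apply: eq_bigr => c _; rewrite (Ex_bool P (b := fun x => `[< X x = c /\ A x >]))//.
  by congr pr; apply/seteqP; split=> x /=; [move/asboolP|move=> ?; apply/asboolP].
apply/funext => x; rewrite (bigD1 (Ordinal (XK x : (X x < K.+1)%N)))//= big1 ?addr0.
  by congr (nat_of_bool _)%:R; apply/asboolP/asboolP => [|[]].
move=> i; rewrite -val_eqE/= => iX; case: asboolP => // -[Xi _].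
by rewrite Xi eqxx in iX.
Qed.

(** A decreasing filtration with marks: h n is uniform on {0, ..., n} and
    independent of F n, which is what the last clause says, while F n contains
    the information on the mark of time n + 1. *)
Definition innovation (F : nat -> set (set T)) (h : nat -> T -> nat) : Prop :=
  forall n, [/\ sigma_algebra setT (F n), F n `<=` measurable, F n.+1 `<=` F n,
   nat_measurable (F n) (h n.+1) /\ (forall x, (h n x <= n)%N) &
   forall c B, (c <= n)%N -> F n B ->
     pr ([set x | h n x = c] `&` B) = pr B / n.+1%:R].

Section theory.
Context (F : nat -> set (set T)) (h : nat -> T -> nat).
Hypothesis inn : innovation F h.

Lemma inn_sigma n : sigma_algebra setT (F n). Proof. by case: (inn n). Qed.
Lemma inn_meas n : F n `<=` measurable. Proof. by case: (inn n). Qed.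
Lemma inn_le n x : (h n x <= n)%N. Proof. by case: (inn n) => _ _ _ []. Qed.
Lemma inn_nm n : nat_measurable (F n) (h n.+1). Proof. by case: (inn n) => _ _ _ []. Qed.
Lemma inn_dec n m : (n <= m)%N -> F m `<=` F n.
Proof.
elim: m => [|m IH]; first by rewrite leqn0 => /eqP ->.
rewrite leq_eqVlt => /predU1P[->//|nm] B FB; apply: IH => //.
by case: (inn m) => _ _ + _ _; apply.
Qed.

Lemma inn_hm n : nat_measurable measurable (h n).
Proof.
case: n => [|n] k; last by apply: inn_meas; exact: inn_nm.
rewrite (_ : [set x | _] = [set _ | 0%N = k]); first exact: (sa_cst sa_measurable).
by apply/seteqP; split=> x /=; have := inn_le 0 x; rewrite leqn0 => /eqP ->.
Qed.

Lemma past_m n m C : past h n (n + m) C -> measurable C.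
Proof. by apply: past_measurable sa_measurable _ C => k _; exact: inn_hm. Qed.

(** Each mark is independent of the later history, so all the marks between n
    and n + m are jointly independent of F (n + m). *)
Lemma past_indep n m C B : past h n (n + m) C -> F (n + m)%N B ->
  pr (B `&` C) = pr B * pr C.
Proof.
elim: m C B => [|m IH] C B pC FB.
  have [[y Cy]|nC] := pselect (exists y, C y).
    have -> : C = setT.
      by apply/seteqP; split=> // x _; apply: (pC y x) => // k; lia.
    by rewrite setIT prT mulr1.
  have -> : C = set0.
    by apply/seteqP; split=> // x Cx; apply: nC; exists x.
  by rewrite setI0 pr0 mulr0.
rewrite addnS in pC FB.
have [D [pD hD]] := past_step pC.
have key B' : F (n + m).+1 B' -> pr (B' `&` C) =
    \sum_(c < (n + m).+2) pr B' / (n + m).+2%:R * pr (D c).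
  move=> FB'.
  rewrite (pr_partition (@inn_le (n + m).+1) (@inn_hm _)); last first.
    apply: measurableI; first exact: inn_meas FB'.
    by rewrite -addnS in pC; exact: past_m pC.
  apply: eq_bigr => c _.
  case: (inn (n + m).+1) => _ _ _ _ hu.
  rewrite -(hu c)//; last by rewrite -ltnS.
  rewrite -IH//; last first.
    apply: (sa_and (inn_sigma _)); first exact: inn_nm.
    by apply: inn_dec FB'.
  congr pr; apply/seteqP; split=> x /=.
    by move=> [hx [Bx /hD]]; rewrite hx.
  by move=> [[hx Bx] Dx]; split=> //; split=> //; apply/hD; rewrite hx.
have := key _ FB; have := key setT (sa_cst (inn_sigma _) True).
rewrite setTI prT => -> ->; rewrite mulr_sumr; apply: eq_bigr => c _.
by rewrite mul1r mulrA.
Qed.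

Lemma past_unif n m (Z : nat -> T -> nat) L : (forall c x, (Z c x <= L)%N) ->
  (forall c, past_fun h n (n + m) (Z c)) ->
  Ex (fun x => (Z (h (n + m).+1 x) x)%:R) =
  Ex (fun x => (\sum_(c < (n + m).+2) Z c x)%N%:R) / (n + m).+2%:R.
Proof.
move=> ZL pZ; apply: (@unif_sum _ _ _ _ _ _ _ L) => //.
- exact: inn_le.
- exact: inn_hm.
- by move=> c k; apply: (@past_m n m); exact: (past_fun_past (Q := fun a => a = k) (pZ c)).
- move=> c a cn.
  rewrite (_ : [set x | _ /\ _] = [set x | h (n + m).+1 x = c] `&` [set x | (a < Z c x)%N])//.
  rewrite (@past_indep n m); last 2 first.
  + exact: (past_fun_past (Q := fun k => (a < k)%N : Prop) (pZ c)).
  + exact: inn_nm.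
  case: (inn (n + m).+1) => _ _ _ _ hu.
  have := hu c setT cn (sa_cst (inn_sigma _) True).
  by rewrite setIT prT => ->; rewrite mulrC mul1r.
Qed.

Lemma fut_unif n (Z : nat -> T -> nat) L : (forall c x, (Z c x <= L)%N) ->
  (forall c, (c <= n)%N -> nat_measurable (F n) (Z c)) ->
  Ex (fun x => (Z (h n x) x)%:R) =
  Ex (fun x => (\sum_(c < n.+1) Z c x)%N%:R) / n.+1%:R.
Proof.
move=> ZL mZ; pose Z' c x := if (c <= n)%N then Z c x else 0%N.
have -> : (fun x => (Z (h n x) x)%:R : R) = fun x => (Z' (h n x) x)%:R.
  by apply/funext => x; rewrite /Z' inn_le.
have -> : (fun x => (\sum_(c < n.+1) Z c x)%N%:R : R) = fun x => (\sum_(c < n.+1) Z' c x)%N%:R.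
  apply/funext => x; congr (_%:R); apply: eq_bigr => c _.
  by rewrite /Z' -ltnS ltn_ord.
have mZ' c : nat_measurable (F n) (Z' c).
  rewrite /Z'; case: (leqP c n) => cn; [exact: mZ|exact: (nm_cst (inn_sigma _))].
apply: (@unif_sum _ _ _ _ _ _ _ L) => //.
- exact: inn_le.
- by move=> c x; rewrite /Z'; case: ifP.
- exact: inn_hm.
- by move=> c k; apply: inn_meas; exact: mZ'.
- move=> c a cn; case: (inn n) => _ _ _ _ hu; rewrite -(hu c _ cn)//.
  exact: (nm_pred (inn_sigma _) (fun k => (a < k)%N : Prop) (mZ' c)).
Qed.

Lemma gap_m n m a b (Q : nat -> Prop) :
  measurable [set x | Q (cutpos h n m b x - cutpos h n m a x)%N].
Proof.
apply: (@past_m n m); apply: past_fun_past => x y hxy.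
by rewrite (cut_past b hxy) (cut_past a hxy).
Qed.

(** An insertion increases a distance d between two cuts with probability
    d/(N+2), where N + 2 is the number of places.  So the probability of a
    distance g after the insertion is a combination of those of g and g - 1
    with total weight (N+1)/(N+2), whence the bound by induction. *)
Lemma gap_law n m a b g : (a < b)%N -> (b <= n.+1)%N ->
  pr [set x | (cutpos h n m b x - cutpos h n m a x)%N = g] <= n.+1%:R / (n + m).+1%:R.
Proof.
move=> ab bn; elim: m g => [|m IH] g.
  by rewrite addn0 divff ?pnatr_eq0//; apply: pr_le1; exact: (@gap_m n 0 a b (fun k => k = g)).
set N := (n + m)%N; pose D x := (cutpos h n m b x - cutpos h n m a x)%N.
pose Z c x : nat := ((cutpos h n m b x + (c < cutpos h n m b x)) -
   (cutpos h n m a x + (c < cutpos h n m a x)) == g)%N.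
have Dgt x : (0 < D x <= N.+1)%N.
  by rewrite /D subn_gt0 cut_lt//= (leq_trans (leq_subr _ _))// cut_le.
have gm (Q : nat -> Prop) : measurable [set x | Q (D x)] by exact: gap_m.
have -> : pr [set x | (cutpos h n m.+1 b x - cutpos h n m.+1 a x)%N = g] =
    Ex (fun x => (Z (h N.+1 x) x)%:R).
  have e : [set x | (cutpos h n m.+1 b x - cutpos h n m.+1 a x)%N = g] =
      [set x | (cutpos h n m b x + (h N.+1 x < cutpos h n m b x)) -
         (cutpos h n m a x + (h N.+1 x < cutpos h n m a x)) == g]%N.
    by apply/seteqP; split=> x; rewrite /mkset !cutS => /eqP.
  rewrite e -Ex_bool// -e; exact: (@gap_m n m.+1 a b (fun k => k = g)).
rewrite (@past_unif n m Z 1); last 2 first.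
- by move=> c x; rewrite /Z; case: (_ == _).
- by move=> c x y hxy; rewrite /Z (cut_past b hxy) (cut_past a hxy).
(* Among the N + 2 places, D x lie between the two cuts. *)
have eZ x : (\sum_(c < N.+2) Z c x)%N = (g.-1 * (D x == g.-1) * (0 < g) + (N.+2 - g) * (D x == g))%N.
  have ltab : (cutpos h n m a x < cutpos h n m b x)%N by exact: cut_lt.
  have bN : (cutpos h n m b x <= N.+1)%N by exact: cut_le.
  rewrite (eq_bigr (fun c : 'I_N.+2 =>
    ((cutpos h n m a x <= c < cutpos h n m b x) * ((D x).+1 == g) +
    (1 - (cutpos h n m a x <= c < cutpos h n m b x)) * (D x == g))%N)).
    rewrite big_split/= -!big_distrl/= sum_itv//; try lia.
    rewrite -/(D x).
    have -> : (\sum_(i < N.+2) (1 - (cutpos h n m a x <= i < cutpos h n m b x)) = N.+2 - D x)%N.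
      have := sum_itv (ltnW ltab) (leqW bN).
      rewrite -/(D x) => e; have := Dgt x => Dx.
      apply/eqP; rewrite -(eqn_add2r (D x)) subnK; last by lia.
      rewrite -e -big_split/= (eq_bigr (fun=> 1%N)).
        by rewrite sum1_card card_ord.
      by move=> i _; case: (_ <= _ < _)%N.
    have := Dgt x; case: g @Z => [|g] Z Dx /=.
      by have -> : (D x == 0%N) = false by [lia]; rewrite /= ?muln0 ?mul0n.
    rewrite muln1 eqSS mulnC; congr (_ + _)%N.
      by case: eqP => [->|]; rewrite ?mul0n ?mul1n ?muln1 ?muln0.
    by case: eqP => [->|]; rewrite ?muln0.
  move=> c _; rewrite /Z; have -> : (D x) = (cutpos h n m b x - cutpos h n m a x)%N by [].
  by case: (ltnP c (cutpos h n m b x)) => h1; case: (ltnP c (cutpos h n m a x)) => h2; lia.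
have -> : (fun x => (\sum_(c < N.+2) Z c x)%N%:R : R) =
  fun x => (g.-1 * (0 < g))%N%:R * (D x == g.-1)%N%:R + (N.+2 - g)%N%:R * (D x == g)%:R.
  by apply/funext => x; rewrite eZ -!natrM -natrD; congr (_%:R); lia.
have mD k : measurable [set x | D x == k].
  rewrite (_ : [set x | _] = [set x | D x = k]); first exact: (gm (fun l => l = k)).
  by apply/seteqP; split=> x /= /eqP.
have bD k : bounded_mfun (fun x => (D x == k)%:R : R) by exact: bounded_mfun_bool.
rewrite ExD ?ExZ//; try exact: bounded_mfunZ.
rewrite !(Ex_bool P (b := fun x => D x == _))//.
have prD k : pr [set x | D x == k] <= n.+1%:R / N.+1%:R.
  apply: le_trans (IH k); rewrite le_eqVlt; apply/orP; left; apply/eqP.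
  by congr pr; apply/seteqP; split=> x /= /eqP.
have prD0 k : (k == 0%N) || (N.+1 < k)%N -> pr [set x | D x == k] = 0.
  move=> hk; rewrite (_ : [set x | _] = set0) ?pr0//.
  by apply/seteqP; split=> x //= /eqP Dk; have := Dgt x; lia.
rewrite addnS -/N.
apply: (@le_trans _ _ (N.+1%:R * (n.+1%:R / N.+1%:R) / N.+2%:R)); last first.
  by rewrite mulrC [_ * (_ / _)]mulrC divfK ?pnatr_eq0// mulrC.
rewrite ler_pM2r ?invr_gt0 ?ltr0n//.
have b0 : 0 <= n.+1%:R / N.+1%:R :> R by rewrite divr_ge0.
have [g0|g0] := boolP ((g == 0%N) || (N.+1 < g)%N).
  rewrite (prD0 g g0) mulr0 addr0.
  have [gN|gN] := eqVneq g N.+2.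
    rewrite gN /= muln1; apply: ler_wpM2l => //; exact: prD.
  have -> : (g.-1 * (0 < g))%N%:R * pr [set x | D x == g.-1] = 0.
    move: g0 gN => /orP[/eqP ->|g0 gN]; first by rewrite mul0r.
    by rewrite (prD0 g.-1) ?mulr0//; lia.
  by rewrite mulr_ge0.
set beta := n.+1%:R / N.+1%:R in b0 prD *.
have -> : N.+1%:R = (g.-1 * (0 < g))%N%:R + (N.+2 - g)%N%:R :> R.
  by rewrite -natrD; congr (_%:R); lia.
by rewrite mulrDl lerD// ler_wpM2l.
Qed.

Lemma gap_window n m a b z w : (a < b)%N -> (b <= n.+1)%N ->
  pr [set x | (z <= cutpos h n m b x - cutpos h n m a x < z + w)%N] <=
    w%:R * (n.+1%:R / (n + m).+1%:R).
Proof.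
move=> ab bn; pose D x := (cutpos h n m b x - cutpos h n m a x)%N.
have gm (Q : nat -> Prop) : measurable [set x | Q (D x)] by exact: gap_m.
have mD k : measurable [set x | D x == k].
  rewrite (_ : [set x | _] = [set x | D x = k]); first exact: (gm (fun l => l = k)).
  by apply/seteqP; split=> x /= /eqP.
rewrite -(Ex_bool P (b := fun x => _)); last exact: (gm (fun k => (z <= k < z + w)%N : Prop)).
have -> : (fun x => (z <= cutpos h n m b x - cutpos h n m a x < z + w)%N%:R : R) =
    fun x => \sum_(i < w) (D x == z + i)%N%:R.
  apply/funext => x; rewrite -/(D x) -natr_sum; congr (_%:R).
  elim: w => [|w IH]; first by rewrite big_ord0; lia.
  by rewrite big_ord_recr/= -IH; lia.
rewrite (@Ex_sum _ _ _ _ _ (fun i x => (D x == z + i)%N%:R)); last first.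
  by move=> i _; exact: bounded_mfun_bool.
rewrite mulr_natl -[w in leRHS]card_ord -sumr_const; apply: ler_sum => i _.
rewrite (Ex_bool P (b := fun x => D x == (z + i)%N))//.
apply: le_trans (@gap_law n m a b (z + i)%N ab bn).
rewrite le_eqVlt; apply/orP; left; apply/eqP.
by congr pr; apply/seteqP; split=> x /= /eqP.
Qed.

End theory.
End innovation.

(** * Asymptotic relative positions *)

Lemma incr_ratio (R : realType) (p N e : nat) : (p <= N.+1)%N -> (e <= 1)%N ->
  `|(p + e)%:R / N.+2%:R - p%:R / N.+1%:R| <= N.+2%:R^-1 :> R.
Proof.
move=> pN e1.
have N0 : (0 : R) < N.+1%:R by rewrite ltr0n.
have N1 : (0 : R) < N.+2%:R by rewrite ltr0n.
have -> : (p + e)%:R / N.+2%:R - p%:R / N.+1%:R =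
   (e%:R * N.+1%:R - p%:R) / N.+1%:R * N.+2%:R^-1 :> R.
  rewrite -[N.+2%:R]natr1 natrD; move: (N.+1%:R : R) N0 => c c0.
  by field; apply/andP; split; lra.
have i0 k : 0 <= k.+1%:R^-1 :> R by rewrite invr_ge0.
rewrite normrM [X in _ * X]ger0_norm// ler_piMl//.
rewrite normrM [X in _ * X]ger0_norm// ler_pdivrMr// mul1r.
rewrite ler_norml; have pN' : p%:R <= N.+1%:R :> R by rewrite ler_nat.
have e0 : 0 <= e%:R :> R by []. have e1' : e%:R <= 1 :> R by rewrite lern1.
have p0 : 0 <= p%:R :> R by [].
by apply/andP; split; nra.
Qed.

Lemma cvg_eventually (R : realType) (u : nat -> R) (l e : R) : u @ \oo --> l -> 0 < e ->
  exists m, forall k, (m <= k)%N -> `|l - u k| < e.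
Proof. by move=> /cvgrPdist_lt/[apply] -[m _ hm]; exists m. Qed.

Section forward.
Context {R : realType} {d} {T : measurableType d} (P : probability T R).
Context (F : nat -> set (set T)) (h : nat -> T -> nat).
Hypothesis inn : innovation P F h.
Local Notation pr := (pr P).
Local Notation Ex := (Ex P).

(** With N + 1 letters, (cut position)/(N + 2) is a bounded martingale in N: an
    insertion moves the cut p with probability p/(N+2), so the mean of the new
    position is p (N+3)/(N+2). *)
Lemma cut_cvg n b : (b <= n.+1)%N ->
  {ae P, forall x, cvgn (fun k => (cutpos h n (4 ^ k - n) b x)%:R / (4 ^ k).+2%:R : R)}.
Proof.
move=> bn.
pose S k x := cutpos h n (k - n) b x.
have Sm k : nat_measurable measurable (S k).
  move=> j; apply: (@past_m _ _ _ _ _ _ inn n (k - n)%N).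
  exact: (past_fun_past (Q := fun a => a = j) (@cut_past _ h n (k - n) b)).
have Sle k x : (S k x <= (n + k).+1)%N.
  apply: leq_trans (cut_le _ _ _ bn) _; rewrite ltnS leq_add2l; exact: leq_subr.
have Sle' k x : (n <= k)%N -> (S k x <= k.+1)%N.
  by move=> nk; have := cut_le h (k - n) x bn; rewrite subnKC.
have bS k : bounded_mfun (fun x => (S k x)%:R : R) by apply: bounded_mfun_nat (Sm k) _ => x; exact: Sle.
pose X k x : R := (S k x)%:R / k.+2%:R.
have bX k : bounded_mfun (X k).
  rewrite /X (_ : (fun x => _) = fun x => k.+2%:R^-1 * (S k x)%:R); first exact: bounded_mfunZ.
  by apply/funext => x; rewrite mulrC.
have Sstep k x : (n <= k)%N -> S k.+1 x = (S k x + (h k.+1 x < S k x))%N.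
  by move=> nk; rewrite /S subSn// cutS subnKC.
have orth j l : (n <= j)%N -> (j <= l)%N -> Ex (fun x => X j x * X l.+1 x) = Ex (fun x => X j x * X l x).
  move=> nj jl.
  have bSS k k' : bounded_mfun (fun x => (S k x * S k' x)%N%:R : R).
    rewrite (_ : (fun x => _) = fun x => (S k x)%:R * (S k' x)%:R); first exact: bounded_mfunM.
    by apply/funext => x; rewrite natrM.
  have EX k k' : Ex (fun x => X k x * X k' x) =
     (k.+2%:R * k'.+2%:R)^-1 * Ex (fun x => (S k x * S k' x)%N%:R).
    rewrite -ExZ//; congr Ex; apply/funext => x.
    by rewrite /X natrM invfM; ring.
  rewrite !EX.
  have nl : (n <= l)%N := leq_trans nj jl.
  have U := @past_unif _ _ _ _ _ _ inn n (l - n)%N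
    (fun c x => S j x * (c < S l x))%N (n + j).+1.
  rewrite subnKC// in U.
  have {}U : Ex (fun x => (S j x * (h l.+1 x < S l x))%N%:R) = Ex (fun x => (S j x * S l x)%N%:R) / l.+2%:R.
    rewrite U.
    - congr (Ex _ / _); apply/funext => x; congr (_%:R).
      rewrite -big_distrr/=; congr (_ * _)%N.
      by rewrite sum_ltn// (leq_trans (Sle' _ x nl)).
    - by move=> c x; rewrite (leq_trans _ (Sle j x))//; case: (_ < _)%N; rewrite ?muln1 ?muln0.
    - move=> c x y hxy.
      have pw k : (n <= k)%N -> (k <= l)%N -> S k x = S k y.
        move=> nk kl; have := @cut_past _ h n (k - n) b; rewrite subnKC//.
        by move=> /(past_funW kl); apply.
      by rewrite !pw.
  have -> : Ex (fun x => (S j x * S l.+1 x)%N%:R) =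
     Ex (fun x => (S j x * S l x)%N%:R) + Ex (fun x => (S j x * (h l.+1 x < S l x))%N%:R).
    rewrite -ExD//.
      by congr Ex; apply/funext => x; rewrite Sstep// mulnDr natrD.
    apply: (@bounded_mfun_nat _ _ _ _ (n + j).+1).
      apply: (nm_op2 sa_measurable muln (Sm j)); apply: (nm_bool sa_measurable).
      exact: (nm_rel sa_measurable (fun a c => (a < c)%N : Prop) (inn_hm inn l.+1) (Sm l)).
    by move=> x; rewrite (leq_trans _ (Sle j x))//; case: (_ < _)%N; rewrite ?muln1 ?muln0.
  rewrite U; set e := Ex _.
  rewrite -[l.+3%:R]natr1.
  have l0 : (0 : R) < l.+2%:R by rewrite ltr0n.
  have j0 : (0 : R) < j.+2%:R by rewrite ltr0n.
  move: (l.+2%:R : R) (j.+2%:R : R) l0 j0 => c c' c0 c'0.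
  by field; apply/and3P; split; lra.
have := @orth_increments_cvg _ _ _ P X n bX; apply.
- move=> k x nk; rewrite /X Sstep//.
  apply: (@le_trans _ _ k.+3%:R^-1); last by rewrite lef_pV2 ?posrE ?ltr0n// ler_nat.
  apply: incr_ratio; last by case: (_ < _)%N.
  by rewrite (leq_trans (Sle' _ x nk)).
- move=> k l nk kl.
  have bXX i j : bounded_mfun (fun x => X i x * X j x) by exact: bounded_mfunM.
  rewrite (_ : (fun x => _) = fun x => (X k.+1 x * X l.+1 x - X k.+1 x * X l x) -
     (X k x * X l.+1 x - X k x * X l x)); last by apply/funext => x; ring.
  rewrite ExB; try exact: bounded_mfunB.
  rewrite !ExB//; rewrite !orth ?subrr//; first exact: ltnW.
  exact: leqW.
Qed.

(** By [gap_law], a distance below N/(r+1) in the word N has probability of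
    order 1/(r+1); hence almost surely, for some r, the distance is at least
    N/(r+1) for infinitely many N = 4^k. *)
Lemma liminf_gap n a b : (a < b)%N -> (b <= n.+1)%N ->
  {ae P, forall x, exists r : nat, forall m, exists2 k, (m <= k)%N &
     (4 ^ k <= (cutpos h n (4 ^ k - n) b x - cutpos h n (4 ^ k - n) a x) * r.+1)%N}.
Proof.
move=> ab bn; pose D k x := (cutpos h n (4 ^ k - n) b x - cutpos h n (4 ^ k - n) a x)%N.
have mD (Q : nat -> Prop) k : measurable [set x | Q (D k x)] by exact: (gap_m inn).
pose E r := [set x | exists m, forall k, (m <= k)%N -> (D k x * r.+1 < 4 ^ k)%N].
have sa_measurable' r : measurable (E r).
  apply: (sa_ex sa_measurable) => m; apply: (sa_all sa_measurable) => k; apply: (sa_imp sa_measurable).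
    exact: (sa_cst sa_measurable).
  exact: (mD (fun l => l * r.+1 < 4 ^ k)%N).
pose N := [set x | forall r, E r x].
have mN : measurable N by apply: (sa_all sa_measurable) => r; exact: sa_measurable'.
have small r : pr (E r) <= (2 * n.+1%:R + 1) / r.+1%:R.
  pose A k := [set x | E r x /\ (4 ^ k <= D k x * r.+1)%N].
  have mA k : measurable (A k).
    apply: (sa_and sa_measurable); first exact: sa_measurable'.
    exact: (mD (fun l => 4 ^ k <= l * r.+1)%N).
  have r0 : (0 : R) < r.+1%:R^-1 by rewrite invr_gt0 ltr0n.
  have [||k0 hk0] := @ae_eventually_pr _ _ _ P A (r.+1%:R^-1) mA.
  - apply: aeW => x.
    have [[m hm]|nE] := pselect (E r x); last by exists 0%N => k _ [].
    by exists m => k mk [_]; have := hm k mk; lia.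
  - exact: r0.
  pose k := maxn k0 (maxn r n).
  pose w := (4 ^ k %/ r.+1).+1.
  have nk : (n <= 4 ^ k)%N.
    by rewrite (leq_trans _ (ltnW (ltn_expl k _)))// /k; lia.
  have rk : (r < 4 ^ k)%N.
    by rewrite (leq_ltn_trans _ (ltn_expl k _))// /k; lia.
  have sub : E r `<=` A k `|` [set x | (0 <= D k x < 0 + w)%N].
    move=> x Ex; have [h1|h1] := leqP (4 ^ k) (D k x * r.+1).
      by left; split.
    by right => /=; rewrite add0n /w ltnS leq_divRL// ltnW.
  have mw : measurable [set x | (0 <= D k x < 0 + w)%N] by exact: (mD (fun l => 0 <= l < 0 + w)%N).
  have h1 : pr (E r) <= pr (A k) + pr [set x | (0 <= D k x < 0 + w)%N].
    apply: le_trans (pr_U P (mA k) mw); apply: pr_le => //; exact: measurableU.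
  apply: (le_trans h1).
  have h2 := hk0 k (leq_maxl _ _).
  have := @gap_window _ _ _ _ _ _ inn n (4 ^ k - n) a b 0 w ab bn.
  rewrite subnKC// -/(D k _) => h3.
  have h4 : w%:R * (n.+1%:R / (4 ^ k).+1%:R) <= (2 * n.+1%:R) / r.+1%:R :> R.
    rewrite mulrA ler_pdivrMr ?ltr0n// [leRHS]mulrAC ler_pdivlMr ?ltr0n//.
    rewrite -!natrM ler_nat mulnAC [leqRHS]mulnAC leq_mul2r; apply/orP; right.
    by rewrite /w; have := leq_trunc_div (4 ^ k) r.+1; lia.
  rewrite mulrDl mul1r addrC lerD//; exact: le_trans h3 h4.
have N0 : pr N = 0.
  apply/eqP; rewrite eq_le pr_ge0 andbT leNgt; apply/negP => p0.
  pose c : R := 2 * n.+1%:R + 1.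
  have c0 : 0 < c by rewrite /c ltr_wpDl// mulr_ge0.
  pose r := Num.truncn (c / pr N).
  have : pr N <= c / r.+1%:R by apply: le_trans (small r); apply: pr_le => // x; apply.
  rewrite leNgt ltr_pdivrMr ?ltr0n// mulrC -ltr_pdivrMr//.
  by rewrite truncnS_gt.
have : P.-negligible N by apply/negligibleP => //; have := prE P mN; rewrite N0.
apply: negligibleS => x /= nx r; apply: contrapT => nE; apply: nx; exists r => m.
apply: contrapT => h1; apply: nE; exists m => k mk; rewrite ltnNge.
by apply/negP => h2; apply: h1; exists k.
Qed.

(** Essentially: the asymptotic relative position of letter j is less than a/b.
    It is stated as an event, and not through the limit, so that it makes sense
    everywhere and is invariant under the passage from one word to the next. *)
Definition below (a b n j : nat) (x : T) : Prop :=
  exists m, forall k, (m <= k)%N -> (cutpos h n (4 ^ k - n) j.+1 x * b < a * (4 ^ k).+2)%N.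

(** The relative positions of the two letters converge, and their limits
    differ by [liminf_gap]; a/b is a rational number in between. *)
Lemma below_separates n i j : (i < j)%N -> (j <= n)%N ->
  {ae P, forall x, exists a b, below a b n i x /\ ~ below a b n j x}.
Proof.
move=> ij jn.
have hi := @cut_cvg n i.+1 (leq_trans ij (leqW jn)).
have hj := @cut_cvg n j.+1 jn.
have hg := @liminf_gap n i.+1 j.+1 ij jn.
apply: filterS3 hi hj hg => x /cvg_ex[li hi] /cvg_ex[lj hj] [r hr].
pose ui k := cutpos h n (4 ^ k - n) i.+1 x.
pose uj k := cutpos h n (4 ^ k - n) j.+1 x.
have dl : 0 < lj - li.
  have hd : (fun k => (uj k)%:R / (4 ^ k).+2%:R - (ui k)%:R / (4 ^ k).+2%:R : R) @ \oo --> lj - li.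
    exact: cvgB.
  rewrite ltNge; apply/negP => l0.
  pose del : R := (3 * r.+1%:R)^-1.
  have del0 : 0 < del by rewrite invr_gt0 mulr_gt0.
  have [m hm] := cvg_eventually hd del0.
  have [k mk hk] := hr m.
  have := hm k mk; rewrite /= ltr_norml => /andP[+ _].
  rewrite ltrBrDr => h1.
  have h2 : del <= (uj k)%:R / (4 ^ k).+2%:R - (ui k)%:R / (4 ^ k).+2%:R.
    rewrite -mulrBl -natrB; last by apply: ltnW; exact: cut_lt.
    rewrite ler_pdivlMr ?ltr0n// /del mulrC ler_pdivrMr ?mulr_gt0//.
    rewrite -!natrM ler_nat -/(ui k) -/(uj k) in hk *.
    have : (0 < 4 ^ k)%N by rewrite expn_gt0.
    move: hk; rewrite -/(ui k) -/(uj k).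
    have := (uj k - ui k)%N; move: (4 ^ k)%N; lia.
  have := le_lt_trans _ (lt_le_trans h1 l0).
  by move=> /(_ 0); rewrite ltxx addrC subr_ge0 => /(_ h2).
(* The denominator makes 1/b smaller than half of the distance of the limits. *)
pose b := (Num.truncn (2 / (lj - li))).+1.
have b0 : 0 < b%:R :> R by rewrite ltr0n.
have bgt : 2 < b%:R * (lj - li).
  by rewrite -ltr_pdivrMr//; exact: truncnS_gt.
have li0 : 0 <= li.
  rewrite -(cvg_lim _ hi)//; apply: limr_ge; first by apply/cvg_ex; exists li.
  by apply: nearW => k; rewrite divr_ge0.
pose a := (Num.truncn (b%:R * li)).+1.
have [a1 a2] : b%:R * li < a%:R /\ a%:R <= b%:R * li + 1.
  split; first exact: truncnS_gt.
  by rewrite /a -natr1 lerD2r truncn_le// mulr_ge0// ltW.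
exists a, b; split.
  have e0 : 0 < a%:R / b%:R - li by rewrite subr_gt0 ltr_pdivlMr// mulrC.
  have [m hm] := cvg_eventually hi e0.
  exists m => k mk; have := hm k mk; rewrite /= distrC ltr_norml => /andP[_].
  rewrite ltrBlDr subrK ltr_pdivrMr ?ltr0n// mulrAC ltr_pdivlMr//.
  by rewrite -!natrM ltr_nat.
have e0 : 0 < lj - a%:R / b%:R.
  rewrite subr_gt0 ltr_pdivrMr//; nra.
have [m hm] := cvg_eventually hj e0.
move=> [m' hm']; pose k := maxn m m'.
have := hm' k (leq_maxr _ _).
have := hm k (leq_maxl _ _); rewrite /= ltr_norml => /andP[_].
rewrite ltrBlDr -ltrBlDl opprB addrCA subrr addr0 ltr_pdivlMr ?ltr0n// mulrAC ltr_pdivrMr//.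
rewrite -!natrM ltr_nat; lia.
Qed.

End forward.

(** * Sorting the codes of the letters *)

Lemma lexlt_measurable T (G : set (set T)) (b c : T -> nat -> bool) :
  sigma_algebra setT G -> (forall l, G [set x | b x l]) ->
  (forall l, G [set x | c x l]) -> G [set x | lexlt (b x) (c x)].
Proof.
move=> sG mb mc.
rewrite (_ : [set x | _] = [set x | exists l, (forall k, (k < l)%N -> (b x k <-> c x k)) /\
   (~ b x l /\ c x l)]).
  apply: (sa_ex sG) => l; apply: (sa_and sG); last first.
    by apply: (sa_and sG); [exact: (sa_not sG)|exact: mc].
  apply: (sa_all sG) => k; apply: (sa_imp sG); first exact: (sa_cst sG).
  exact: (sa_iff sG).
apply/seteqP; split=> x /=.
  move=> /asboolP[l [hl [bl cl]]]; exists l; split; last by rewrite bl cl.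
  by move=> k /hl ->.
move=> [l [hl [/negP/negbTE bl cl]]]; apply/asboolP; exists l; split => // k /hl e.
by apply/idP/idP => /e.
Qed.

(** In this section v n j x is the code of the letter j of the word of index n.
    The codes follow the letters ([codes_step]) and are almost surely distinct
    within a word. *)
Section core.
Context {R : realType} {d} {T : measurableType d} (P : probability T R).
Context (F : nat -> set (set T)) (h : nat -> T -> nat).
Hypothesis inn : innovation P F h.
Hypothesis Ffull : forall n B, measurable B -> {ae P, forall x, B x} -> F n B.
Hypothesis tail : forall B, (forall n, F n B) -> pr P B = 0 \/ pr P B = 1.
Context (v : nat -> nat -> T -> nat -> bool).
Hypothesis codes_m : forall n j l, F n [set x | v n j x l].
Hypothesis codes_step : forall n j x, (j <= n)%N -> v n j x = v n.+1 (bump (h n.+1 x) j) x.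

Definition sep_at n x := rank_separated lexlt (fun j => v n j x) n.
Hypothesis codes_sep : {ae P, forall x, forall n, sep_at n x}.
Local Notation pr := (pr P).
Local Notation Ex := (Ex P).
Let sF n := inn_sigma inn n.

Lemma code_lt_m n i j : F n [set x | lexlt (v n i x) (v n j x)].
Proof. exact: lexlt_measurable. Qed.

Lemma sep_m n : F n [set x | sep_at n x].
Proof.
apply: (sa_all (sF n)) => i; apply: (sa_all (sF n)) => j.
do 3 (apply: (sa_imp (sF n)); first exact: (sa_cst (sF n))).
rewrite (_ : [set x | _] = [set x | lexlt (v n i x) (v n j x) \/ lexlt (v n j x) (v n i x)]).
  by apply: (sa_or (sF n)); exact: code_lt_m.
by apply/seteqP; split=> x /orP.
Qed.

Definition Sep := [set x | forall n, sep_at n x].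

Lemma Sep_m : measurable Sep.
Proof. by apply: (sa_all sa_measurable) => n; apply: (inn_meas inn); exact: sep_m. Qed.

Definition vrank n j x := rank lexlt (fun j => v n j x) n j.

Lemma vrank_nm n j : nat_measurable (F n) (vrank n j).
Proof.
apply: (nm_sum (sF n) (f := fun k x => lexlt (v n k x) (v n j x) : nat)) => k _.
by apply: (nm_bool (sF n)); exact: code_lt_m.
Qed.

(** The new mark: the place of the erased letter once the word is sorted by
    codes. *)
Definition resorted n x := vrank n (h n x) x.

Lemma resorted_le n x : (resorted n x <= n)%N.
Proof. by apply: (rank_le lexlt_irr); exact: (inn_le inn). Qed.

(** Given F n, the ranks of the letters of the word n form a known permutation,
    and a permutation known from F n maps a mark which is uniform and
    independent of F n to another one. *)
Lemma resorted_innovation : innovation P F resorted.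
Proof.
move=> n; split; [exact: sF|exact: (inn_meas inn)|exact: (inn_dec inn)| |].
  split; last exact: resorted_le.
  apply: (nm_pickf (sF n)); first exact: (inn_nm inn).
  by move=> k j; apply: (inn_dec inn (leqnSn n)); exact: vrank_nm.
move=> c B cn FB.
have FS : F n Sep by apply: Ffull => //; exact: Sep_m.
have FB' : F n (B `&` Sep) by exact: (sa_and (sF n)).
have mB' := inn_meas inn FB'; have mB := inn_meas inn FB.
have mxi : measurable [set x | resorted n x = c].
  apply: (nm_pick sa_measurable (g := h n) (A := fun k x => vrank n k x = c)).
    exact: (inn_hm inn).
  by move=> k; apply: (inn_meas inn); exact: vrank_nm.
have aeS : {ae P, forall x, Sep x} by exact: codes_sep.
have -> : pr B = pr (B `&` Sep).
  by apply: pr_ae => //; apply: filterS aeS => x Sx; split=> [Bx|[]].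
transitivity (pr ([set x | resorted n x = c] `&` (B `&` Sep))).
  apply: pr_ae; [exact: measurableI|exact: measurableI|].
  by apply: filterS aeS => x Sx; split=> [[? ?]|[? []]].
pose Z k x : nat := `[< (B `&` Sep) x /\ vrank n k x = c >].
have mZ k : F n [set x | `[< (B `&` Sep) x /\ vrank n k x = c >]].
  rewrite (_ : [set x | _] = [set x | (B `&` Sep) x /\ vrank n k x = c]).
    by apply: (sa_and (sF n)) => //; exact: vrank_nm.
  by apply/seteqP; split=> x; rewrite /mkset => /asboolP.
have U := @fut_unif _ _ _ P _ _ inn n Z 1.
have {}U : Ex (fun x => (Z (h n x) x)%:R) = Ex (fun x => (\sum_(c < n.+1) Z c x)%N%:R) / n.+1%:R.
  apply: U; first by move=> k x; rewrite /Z; case: asboolP.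
  by move=> k _; apply: (nm_bool (sF n)); exact: mZ.
have e1 : [set x | resorted n x = c] `&` (B `&` Sep) =
    [set x | `[< (B `&` Sep) x /\ vrank n (h n x) x = c >]].
  by apply/seteqP; split=> x; rewrite /mkset; [move=> [? ?]; apply/asboolP|move/asboolP => -[]].
have e2 : B `&` Sep = [set x | `[< (B `&` Sep) x >]].
  by apply/seteqP; split=> x; rewrite /mkset; [move=> ?; apply/asboolP|move/asboolP].
rewrite e1 -Ex_bool; last by rewrite -e1; exact: measurableI.
rewrite U; congr (_ / _).
rewrite [in RHS]e2 -Ex_bool; last by rewrite -e2.
congr Ex; apply/funext => x; congr (_%:R).
case: asboolP => [Bx|nB].
  rewrite -[RHS]/1%N -(rank_sum1 lexlt_irr lexlt_trans (Bx.2 n) cn).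
  apply: eq_bigr => k _; rewrite /Z; congr nat_of_bool.
  by apply/asboolP/eqP => [[]|].
by rewrite big1// => k _; rewrite /Z; case: asboolP => // -[].
Qed.

Section trajectory.
Variables (n : nat) (x : T).
Hypothesis Sx : Sep x.

Lemma cutpos_gt0 (g : nat -> T -> nat) m j : (0 < cutpos g n m j.+1 x)%N.
Proof. by have := @cut_lt _ g n m 0 j.+1 x isT; rewrite cut0. Qed.

(** Along the words n, n + 1, ..., the letters move by insertions at h and their
    ranks move by insertions at the new marks. *)
Lemma trajectory m j : (j <= n)%N ->
  v n j x = v (n + m) (cutpos h n m j.+1 x).-1 x /\
  (cutpos resorted n m (vrank n j x).+1 x).-1 = vrank (n + m) (cutpos h n m j.+1 x).-1 x.
Proof.
move=> jn; elim: m => [|m [IH1 IH2]]; first by rewrite addn0.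
have p0 := cutpos_gt0 h m j.
have q0 := cutpos_gt0 resorted m (vrank n j x).
have pN : (cutpos h n m j.+1 x <= (n + m).+1)%N by exact: cut_le.
rewrite !cutS addnS; move: IH1 IH2 p0 q0 pN.
case: (cutpos h n m j.+1 x) => // p; case: (cutpos resorted n m _ x) => // q /= IH1 IH2 _ _ pN.
have bE a b : (b + (a < b.+1)%N)%N = bump a b by rewrite /bump ltnS addnC.
rewrite !bE IH1 IH2; split; first exact: codes_step.
rewrite /vrank (@rank_bump _ _ lexlt_irr lexlt_trans _ (fun j => v (n + m) j x))//.
- exact: (inn_le inn).
- by move=> k kn; exact: codes_step.
- exact: Sx.
Qed.

Definition below_count (t : nat -> bool) N y := (\sum_(k < N.+1) lexlt (v N k y) t)%N.

(** Whether the i-th smallest code of the word n is below t can be read in every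
    later word n + m, from the new marks and from one number.  That number is
    then replaced by its asymptotic value, which is deterministic. *)
Lemma below_rank t m i : (i <= n)%N ->
  lexlt (v n (unrank lexlt (fun j => v n j x) n i) x) t =
  (cutpos resorted n m i.+1 x <= below_count t (n + m) x)%N.
Proof.
move=> iN; have [un ur] := unrankK lexlt_irr lexlt_trans (@Sx n) iN.
set j := unrank _ _ _ _ in un ur *.
have [-> e] := trajectory m un.
have pN : (cutpos h n m j.+1 x <= (n + m).+1)%N by exact: cut_le.
have p0 := cutpos_gt0 h m j.
rewrite (rank_lt lexlt_irr lexlt_trans _ _ (@Sx _)); last by lia.
rewrite -/(vrank (n + m) _ x) -e /vrank ur.
by have := cutpos_gt0 resorted m i; case: (cutpos resorted n m i.+1 x).
Qed.
End trajectory.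

Section counts.
Variable t : nat -> bool.
Let S := below_count t.
Let X k x : R := (S k x)%:R / k.+1%:R.

Lemma below_count_nm N : nat_measurable (F N) (S N).
Proof.
apply: (nm_sum (sF N) (f := fun k x => lexlt (v N k x) t : nat)) => k _.
apply: (nm_bool (sF N)); apply: lexlt_measurable => //.
by move=> l; exact: (sa_cst (sF N)).
Qed.

Lemma below_count_le N x : (S N x <= N.+1)%N.
Proof.
rewrite -[leqRHS]card_ord -sum1_card; apply: leq_sum => i _; by case: lexlt.
Qed.

Lemma below_count_step N x : S N.+1 x = (S N x + lexlt (v N.+1 (h N.+1 x) x) t)%N.
Proof.
rewrite /S /below_count (bigD1_bump (fun k => lexlt (v N.+1 k x) t) (inn_le inn N.+1 x)) addnC.
by congr (_ + _)%N; apply: eq_bigr => k _; rewrite [v N _ x]codes_step// -ltnS.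
Qed.

(** The proportion of codes below t is a reversed martingale, as the word of
    index N arises from that of index N + 1 by erasing a uniform letter. *)
Lemma below_cvg : {ae P, forall x, cvgn (fun k => X (4 ^ k)%N x)}.
Proof.
have Sm k : nat_measurable measurable (S k).
  by move=> a; apply: (inn_meas inn); exact: below_count_nm.
have bS k : bounded_mfun (fun x => (S k x)%:R : R) by apply: bounded_mfun_nat (Sm k) _ => x; exact: below_count_le.
have bX k : bounded_mfun (X k).
  rewrite /X (_ : (fun x => _) = fun x => k.+1%:R^-1 * (S k x)%:R); first exact: bounded_mfunZ.
  by apply/funext => x; rewrite mulrC.
have orth j l : (j < l)%N -> Ex (fun x => X j x * X l x) = Ex (fun x => X j.+1 x * X l x).
  move=> jl.
  have bSS k k' : bounded_mfun (fun x => (S k x * S k' x)%N%:R : R).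
    rewrite (_ : (fun x => _) = fun x => (S k x)%:R * (S k' x)%:R); first exact: bounded_mfunM.
    by apply/funext => x; rewrite natrM.
  have EX k k' : Ex (fun x => X k x * X k' x) =
     (k.+1%:R * k'.+1%:R)^-1 * Ex (fun x => (S k x * S k' x)%N%:R).
    rewrite -ExZ//; congr Ex; apply/funext => x.
    by rewrite /X natrM invfM; ring.
  rewrite !EX.
  have U := @fut_unif _ _ _ P _ _ inn j.+1 (fun c x => lexlt (v j.+1 c x) t * S l x)%N l.+1.
  have nmZ c : nat_measurable (F j.+1) (fun x => lexlt (v j.+1 c x) t * S l x)%N.
    apply: (nm_op2 (sF j.+1) muln).
      apply: (nm_bool (sF _)); apply: lexlt_measurable => // l'; exact: (sa_cst (sF _)).
    by move=> k; apply: (inn_dec inn jl); exact: below_count_nm.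
  have Zle c x : (lexlt (v j.+1 c x) t * S l x <= l.+1)%N.
    by rewrite (leq_trans _ (below_count_le l x))//; case: lexlt; rewrite ?mul1n ?mul0n.
  have {}U : Ex (fun x => (lexlt (v j.+1 (h j.+1 x) x) t * S l x)%N%:R) =
      Ex (fun x => (S j.+1 x * S l x)%N%:R) / j.+2%:R.
    rewrite U//; congr (Ex _ / _); apply/funext => x; congr (_%:R).
    by rewrite -big_distrl.
  have E : Ex (fun x => (S j.+1 x * S l x)%N%:R) =
     Ex (fun x => (S j x * S l x)%N%:R) + Ex (fun x => (lexlt (v j.+1 (h j.+1 x) x) t * S l x)%N%:R).
    rewrite -ExD//.
      by congr Ex; apply/funext => x; rewrite below_count_step// mulnDl natrD.
    apply: (@bounded_mfun_nat _ _ _ _ l.+1); last by move=> x; exact: Zle.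
    apply: (nm_pickf sa_measurable (g := h j.+1) (f := fun c x => (lexlt (v j.+1 c x) t * S l x)%N)).
      exact: (inn_hm inn).
    by move=> c k; apply: (inn_meas inn); exact: nmZ.
  move: E; rewrite U; set e := Ex _; set e' := Ex _ => E.
  have -> : e' = e * (1 - j.+2%:R^-1) by rewrite mulrBr mulr1 {1}E addrK.
  rewrite -[j.+2%:R]natr1.
  have l0 : (0 : R) < l.+1%:R by rewrite ltr0n.
  have j0 : (0 : R) < j.+1%:R by rewrite ltr0n.
  move: (l.+1%:R : R) (j.+1%:R : R) l0 j0 => c c' c0 c'0.
  by field; apply/and3P; split; lra.
apply: (@orth_increments_cvg _ _ _ P X 0 bX).
- move=> k x _; rewrite /X below_count_step; apply: incr_ratio; last by case: lexlt.
  exact: below_count_le.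
- move=> k l nk kl.
  have bXX i j : bounded_mfun (fun x => X i x * X j x) by exact: bounded_mfunM.
  rewrite (_ : (fun x => _) = fun x => (X k.+1 x * X l.+1 x - X k x * X l.+1 x) -
     (X k.+1 x * X l x - X k x * X l x)); last by apply/funext => x; ring.
  rewrite ExB; try exact: bounded_mfunB.
  rewrite !ExB//; rewrite [Ex (fun x => X k x * X l.+1 x)]orth ?[Ex (fun x => X k x * X l x)]orth ?subrr//.
  exact: ltnW.
Qed.

(** The events that the proportion is eventually below s belong to the tail, so
    each has probability 0 or 1, and the limit is the threshold c where the
    probability jumps. *)
Lemma below_cvg_cst : exists c : R,
  {ae P, forall x, (fun k => X (4 ^ k)%N x) @ \oo --> c}.
Proof.
pose E (s : R) := [set x | exists m, forall k, (m <= k)%N -> X (4 ^ k)%N x < s].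
have FE s n : F n (E s).
  rewrite (_ : E s = [set x | exists m, forall k, (m <= k)%N -> (n <= k)%N -> X (4 ^ k)%N x < s]).
    apply: (sa_ex (sF n)) => m; apply: (sa_all (sF n)) => k.
    apply: (sa_imp (sF n)); first exact: (sa_cst (sF n)).
    have [nk|nk] := leqP n k; last first.
      rewrite (_ : [set x | _] = [set _ | True]); first exact: (sa_cst (sF n)).
      by apply/seteqP; split=> x.
    apply: (sa_imp (sF n)); first exact: (sa_cst (sF n)).
    apply: (@inn_dec _ _ _ _ _ _ inn n (4 ^ k)).
      by rewrite (leq_trans nk)// ltnW// ltn_expl.
    exact: (nm_pred (sF _) (fun a => a%:R / (4 ^ k).+1%:R < s : Prop) (below_count_nm _)).
  apply/seteqP; split=> x [m hm]; first by exists m => k mk _; exact: hm.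
  by exists (maxn m n) => k; rewrite geq_max => /andP[]; exact: hm.
have E01 s := tail (FE s).
have mE_ s : measurable (E s) by apply: (inn_meas inn); exact: (FE s 0%N).
pose A := [set s | pr (E s) = 0].
have X0 k x : 0 <= X k x by rewrite /X divr_ge0.
have X1 k x : X k x <= 1 by rewrite /X ler_pdivrMr ?ltr0n// mul1r ler_nat below_count_le.
have A0 : A 0.
  rewrite /A /= (_ : E 0 = set0) ?pr0//.
  by apply/seteqP; split=> x //= [m /(_ m (leqnn m))]; rewrite ltNge X0.
have subE s s' : s <= s' -> E s `<=` E s'.
  by move=> ss x [m hm]; exists m => k /hm /lt_le_trans; apply.
have A2 : ubound A 2.
  move=> s As; rewrite leNgt; apply/negP => s2; move: As; rewrite /A /=.
  rewrite (_ : E s = setT) ?prT; first by move/eqP; rewrite oner_eq0.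
  apply/seteqP; split=> // x _; exists 0%N => k _.
  by rewrite (le_lt_trans (X1 _ _))//; lra.
pose c := sup A; exists c.
have hsA : has_sup A by split; [exists 0|exists 2].
have below s : s < c -> pr (E s) = 0.
  move=> sc; have [a Aa sa] := sup_adherent (eps := c - s) (ltac:(by rewrite subr_gt0; exact: sc)) hsA.
  apply/eqP; rewrite eq_le pr_ge0 andbT -Aa; apply: pr_le => //.
  by apply: subE; move: sa; rewrite -/c opprB addrC subrK => /ltW.
have above s : c < s -> pr (E s) = 1.
  move=> cs; have [e0|//] := E01 s.
  by have := ub_le_sup (ex_intro _ 2 A2) (e0 : A s); rewrite -/c leNgt cs.
have aeq (q : rat) : {ae P, forall x, (ratr q < c -> ~ E (ratr q) x) /\ (c < ratr q -> E (ratr q) x)}.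
  have neg B : measurable B -> pr B = 0 -> {ae P, forall x, ~ B x}.
    move=> mB B0; have : P.-negligible B.
      by apply/negligibleP => //; have := prE P mB; rewrite B0.
    by apply: negligibleS => x /= /contrapT.
  have [qc|qc|qc] := ltgtP (ratr q) c.
  - by apply: filterS (neg _ (mE_ _) (below _ qc)) => x nE; split.
  - have : pr (~` E (ratr q)) = 0.
      rewrite /pr probability_setC//.
      have := prE P (mE_ (ratr q)); rewrite above// => ->.
      by rewrite /= subrr.
    move=> /(neg _ (measurableC (mE_ _))); apply: filterS => x /contrapT Ex.
    by split.
  - by apply: aeW => x; split.
have aeall : {ae P, forall x, forall q : rat, (ratr q < c -> ~ E (ratr q) x) /\ (c < ratr q -> E (ratr q) x)}.
  have : {ae P, forall x, forall n, if unpickle n is Some q then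
      (ratr q < c -> ~ E (ratr q) x) /\ (c < ratr q -> E (ratr q) x) else True}.
    by apply: ae_foralln => n; case: (unpickle n) => [q|]; [exact: aeq|exact: aeW].
  by apply: filterS => x hx q; have := hx (pickle q); rewrite pickleK.
apply: filterS2 below_cvg aeall => x /cvg_ex[l hl] hq.
suff -> : c = l by exact: hl.
apply/eqP; rewrite eq_le; apply/andP; split; rewrite leNgt; apply/negP.
  move=> lc; have [q] := rat_in_itvoo lc; rewrite in_itv/= => /andP[lq qc].
  apply: (hq q).1 => //.
  have [m hm] := cvg_eventually hl (e := ratr q - l) (ltac:(by rewrite subr_gt0)).
  exists m => k /hm; rewrite distrC ltr_norml => /andP[_].
  by rewrite ltrBlDr subrK.
move=> cl; have [q] := rat_in_itvoo cl; rewrite in_itv/= => /andP[cq ql].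
have [m hm] := (hq q).2 cq.
have [m' hm'] := cvg_eventually hl (e := l - ratr q) (ltac:(by rewrite subr_gt0)).
have := hm' _ (leq_maxr m m'); have := hm _ (leq_maxl m m').
move=> h1; rewrite ltr_norml => /andP[_]; rewrite ltrBlDr -ltrBlDl opprB addrC subrK.
by move=> /(lt_trans h1); rewrite ltxx.
Qed.

End counts.
Section recover.
Variables (G : set (set T)) (n : nat).
Hypotheses (sG : sigma_algebra setT G) (Gm : G `<=` measurable).
Hypothesis Gmarks : forall k, (n < k)%N -> nat_measurable G (resorted k).

Definition vpos i x := unrank lexlt (fun j => v n j x) n i.

Lemma vpos_nm i : nat_measurable (F n) (vpos i).
Proof.
apply: (nm_sum (sF n) (f := fun j x => (j * (vrank n j x == i))%N)) => j _.
apply: (nm_op2 (sF n) muln); first exact: (nm_cst (sF n)).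
by apply: (nm_op (sF n) (fun a => a == i : nat)); exact: vrank_nm.
Qed.

Lemma vpos_v_m i l : F n [set x | v n (vpos i x) x l].
Proof. by apply: (nm_pick (sF n) (g := vpos i) (A := fun k x => v n k x l)) => //; exact: vpos_nm. Qed.

(** By [below_rank], the code is below t when its sorted position in the word N
    is at most the number S of codes below t.  Replacing S by the integer
    part z of c N changes this event only if S differs from z by more than w,
    which is unlikely as S/N tends to c, or if the sorted position is within w
    of z, which is unlikely by [gap_window] as w is small compared with N. *)
Lemma vpos_lt_completion t i : (i <= n)%N ->
  completion P G [set x | lexlt (v n (vpos i x) x) t].
Proof.
move=> iN.
have mB : measurable [set x | lexlt (v n (vpos i x) x) t].
  apply: (inn_meas inn (n := n)); apply: lexlt_measurable => // l; first exact: vpos_v_m.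
  exact: (sa_cst (sF n)).
have [c hc] := below_cvg_cst t.
apply: completion_approx => // k0.
set e : R := 2^-1 ^+ k0.+1.
have e0 : 0 < e by rewrite exprn_gt0.
pose n1 : R := n.+1%:R.
have n10 : 0 < n1 by rewrite ltr0n.
pose del : R := e / (8 * n1).
have del0 : 0 < del by rewrite divr_gt0// mulr_gt0.
pose A k := [set x | del < `|c - (below_count t (4 ^ k) x)%:R / (4 ^ k).+1%:R|].
have mA k : measurable (A k).
  apply: (inn_meas inn (n := (4 ^ k)%N)).
  exact: (nm_pred (sF _) (fun a => del < `|c - a%:R / (4 ^ k).+1%:R| : Prop) (below_count_nm t _)).
have [||K hK] := @ae_eventually_pr _ _ _ P A (e / 2) mA.
- apply: filterS hc => x hx; have [m hm] := cvg_eventually hx del0.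
  by exists m => k mk; rewrite /A /= => /(lt_trans (hm k mk)); rewrite ltxx.
- by rewrite divr_gt0.
pose K' := maxn K (maxn n (Num.truncn (20 * n1 / e))).
pose N := (4 ^ K')%N.
have nN : (n <= N)%N.
  by rewrite (leq_trans _ (ltnW (ltn_expl K' _)))// /K' !leq_max leqnn orbT.
have bigN : 20 * n1 / e < N.+1%:R.
  apply: (lt_trans (truncnS_gt _)); rewrite ltr_nat ltnS.
  by rewrite (leq_ltn_trans _ (ltn_expl K' _))// /K' !leq_max leqnn !orbT.
pose y : R := N.+1%:R.
have y0 : 0 < y by rewrite ltr0n.
pose z := Num.truncn (c * y).
pose w := (Num.truncn (del * y)).+2.
pose C := [set x | (cutpos resorted n (N - n) i.+1 x <= z)%N].
exists C; split.
  apply: (past_measurable (h := resorted) (n := n) (m := (N - n)%N)) => //.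
    by move=> k /andP[nk _]; exact: Gmarks.
  exact: (past_fun_past (Q := fun a => (a <= z)%N : Prop) (@cut_past _ resorted n (N - n) i.+1)).
have mcut (Q : nat -> Prop) : measurable [set x | Q (cutpos resorted n (N - n) i.+1 x)].
  apply: (past_m resorted_innovation (n := n) (m := (N - n)%N)).
  exact: (past_fun_past (Q := Q) (@cut_past _ resorted n (N - n) i.+1)).
have mC : measurable C by exact: (mcut (fun a => (a <= z)%N : Prop)).
have mBC : measurable ([set x | lexlt (v n (vpos i x) x) t] `+` C).
  by apply: measurableU; exact: measurableD.
pose Win := [set x | (z - w <= cutpos resorted n (N - n) i.+1 x - cutpos resorted n (N - n) 0 x < z - w + (2 * w).+1)%N].
have mWin : measurable Win.
  rewrite /Win (_ : [set x | _] = [set x | (z - w <= cutpos resorted n (N - n) i.+1 x < z - w + (2 * w).+1)%N]).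
    exact: (mcut (fun a => (z - w <= a < z - w + (2 * w).+1)%N : Prop)).
  by apply/seteqP; split=> x; rewrite /mkset cut0 subn0.
have step1 : pr ([set x | lexlt (v n (vpos i x) x) t] `+` C) <= pr (A K' `|` Win).
  rewrite (@pr_ae _ _ _ P _ (([set x | lexlt (v n (vpos i x) x) t] `+` C) `&` Sep))//; last 2 first.
  - by apply: measurableI => //; exact: Sep_m.
  - by apply: filterS codes_sep => x Sx; split=> [?|[]].
  apply: pr_le; [by apply: measurableI => //; exact: Sep_m|exact: measurableU|].
  move=> x [hx Sx].
  have [Ax|nA] := pselect (A K' x); first by left.
  right; have := @below_rank n x Sx t (N - n) i iN.
  rewrite subnKC// -/(vpos i x) => e1.
  have hS : `|c - (below_count t N x)%:R / y| <= del by rewrite leNgt; apply/negP.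
  set S := below_count t N x in hS e1.
  have hS' : `|c * y - S%:R| <= del * y.
    rewrite -[y in leRHS]gtr0_norm// (_ : c * y - S%:R = (c - S%:R / y) * y).
      by rewrite normrM ler_pM2r// normr_gt0 gt_eqF.
    by rewrite mulrBl divfK// gt_eqF.
  have w1 : del * y < w%:R - 1.
    by rewrite /w -natr1 addrK; exact: truncnS_gt.
  have Sz : (S <= z + w)%N /\ (z <= S + w)%N.
    move: hS'; rewrite ler_norml => /andP[h1 h2].
    split.
      rewrite -ltnS -(ltr_nat R) -natr1 natrD.
      have : c * y < z%:R + 1 by rewrite natr1; exact: truncnS_gt.
      by move: h1 w1; lra.
    have [cy|cy] := ltP (c * y) 0.
      by rewrite /z truncn_floor leNgt cy.
    rewrite -(ler_nat R) natrD.
    have : z%:R <= c * y by rewrite truncn_le.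
    by move: h2 w1; lra.
  rewrite /Win /mkset cut0 subn0.
  move: hx; rewrite /setY /C /=.
  rewrite -/(vpos i x) e1.
  by move=> [[h1 /negP]|[h1 /negP]]; rewrite -ltnNge => h2; lia.
apply: (le_trans step1); apply: (le_trans (pr_U P (mA K') mWin)).
have h1 : pr (A K') <= e / 2 by apply: hK; exact: leq_maxl.
have h2 : pr Win <= (2 * w).+1%:R * (n1 / y).
  have := @gap_window _ _ _ _ _ _ resorted_innovation n (N - n) 0 i.+1 (z - w) (2 * w).+1 isT iN.
  by rewrite subnKC.
have h3 : (2 * w).+1%:R * (n1 / y) <= e / 2.
  have : w%:R <= del * y + 2.
    rewrite /w -addn2 natrD lerD2r truncn_le// mulr_ge0// ltW//.
  move=> hw; rewrite -[(2 * w).+1%:R]natr1 natrM.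
  rewrite mulrA ler_pdivrMr//.
  apply: (@le_trans _ _ ((2 * (del * y + 2) + 1) * n1)).
    by rewrite ler_pM2r// lerD2r ler_pM2l.
  have -> : (2 * (del * y + 2) + 1) * n1 = e / 4 * y + 5 * n1.
    by rewrite /del; field; rewrite gt_eqF.
  have : 20 * n1 < e * y by rewrite [e * y]mulrC -ltr_pdivrMr.
  lra.
by move: (lerD h1 (le_trans h2 h3)); rewrite -splitr.
Qed.

(** The bits are found one after the other, by comparison with thresholds: see
    [lexlt_stop]. *)
Lemma vpos_bits_completion i l : (i <= n)%N ->
  completion P G [set x | v n (vpos i x) x l].
Proof.
move=> iN; have sC := completion_sigma P sG Gm.
elim/ltn_ind: l => l IH.
rewrite (_ : [set x | _] = [set x | ~ exists s : l.-tuple bool,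
   (forall k, (k < l)%N -> (v n (vpos i x) x k <-> nth false s k)) /\
   lexlt (v n (vpos i x) x) (lexstop (nth false s) l)]).
  apply: (sa_not sC); apply: (sa_ex sC) => s; apply: (sa_and sC); last exact: vpos_lt_completion.
  apply: (sa_all sC) => k; have [kl|lk] := ltnP k l; last first.
    rewrite (_ : [set x | _] = [set _ | True]); first exact: (sa_cst sC).
    by apply/seteqP; split.
  apply: (sa_imp sC); first exact: (sa_cst sC).
  by apply: (sa_iff sC); [exact: IH|exact: (sa_cst sC)].
apply/seteqP; split=> x /=.
  move=> vl [s [hs]]; rewrite (@lexlt_stop (nth false s)) ?vl//.
  by move=> k kl; apply/idP/idP => /(hs k kl).
move=> h1; apply: contrapT => nv; apply: h1.
exists [tuple v n (vpos i x) x k | k < l].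
have nthE k : (k < l)%N -> nth false [tuple v n (vpos i x) x k | k < l] k = v n (vpos i x) x k.
  by move=> kl; rewrite -(tnth_nth _ _ (Ordinal kl)) tnth_mktuple.
split=> [k kl|]; first by rewrite nthE.
rewrite lexlt_stop; first exact/negP.
by move=> k kl; rewrite nthE.
Qed.

End recover.
End core.

(** * Histories of an erased-word process *)

Section conditional.
Context {R : realType} {d} {T : measurableType d} (P : probability T R).
Variables (B : set T) (mB : measurable B).
Hypothesis B0 : pr P B != 0.

Definition cond : probability T R := mnormalize (mrestr P mB) P.

Lemma condE A : measurable A -> cond A = (pr P (A `&` B) / pr P B)%:E.
Proof.
move=> mA; rewrite /cond /= /mnormalize /=. rewrite /mrestr setTI.
have -> : P B = (pr P B)%:E by exact: prE.
rewrite /= eqe (negbTE B0)/=.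
have -> : P (A `&` B) = (pr P (A `&` B))%:E by apply: prE; exact: measurableI.
by rewrite -EFinM.
Qed.

Lemma cond_ae (Q : T -> Prop) : {ae P, forall x, Q x} -> {ae cond, forall x, Q x}.
Proof.
move=> [N [mN N0 sub]]; exists N; split => //.
rewrite condE// (_ : pr P (N `&` B) = 0) ?mul0r//.
apply/eqP; rewrite eq_le pr_ge0 andbT.
apply: le_trans (pr_le P _ mN (@subIsetl _ N B)) _; first exact: measurableI.
by have := prE P mN; rewrite N0 => -[<-].
Qed.

End conditional.

Section gewp_basics.
Context (R : realType) dA (A : measurableType dA)
  d (Omega : measurableType d) (P : probability Omega R).
Variables (W : forall n, {RV P >-> n.+1.-tuple A})
  (eta : forall n, {RV P >-> 'I_n.+1}).
Local Notation gf := (gewp_filtration W eta).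

Lemma gf_sigma n : sigma_algebra setT (gf n).
Proof. exact: smallest_sigma_algebra. Qed.

Lemma gf_W n k D : (n <= k)%N -> measurable D -> gf n (W k @^-1` D).
Proof.
move=> nk mD; apply: sub_sigma_algebra; exists k => //; left.
by exists D => //; rewrite setTI.
Qed.

Lemma gf_eta n k (J : set 'I_k.+2) : (n <= k)%N -> gf n (eta k.+1 @^-1` J).
Proof.
move=> nk; apply: sub_sigma_algebra; exists k => //; right.
by exists J => //; rewrite setTI.
Qed.

Lemma gf_sub n (G : set (set Omega)) : sigma_algebra setT G ->
  (forall k D, (n <= k)%N -> measurable D -> G (W k @^-1` D)) ->
  (forall k (J : set 'I_k.+2), (n <= k)%N -> G (eta k.+1 @^-1` J)) -> gf n `<=` G.
Proof.
move=> sG GW Geta; apply: smallest_sub => // B [k /= nk [[D mD <-]|[J mJ <-]]];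
  rewrite setTI; [exact: GW|exact: Geta].
Qed.

Lemma gf_meas n : gf n `<=` measurable.
Proof.
apply: gf_sub; first exact: sa_measurable.
- by move=> k D _ mD; rewrite -[X in measurable X]setTI; exact: measurable_funPT.
- by move=> k J _; rewrite -[X in measurable X]setTI; exact: measurable_funPT.
Qed.

Lemma gf_dec n : gf n.+1 `<=` gf n.
Proof.
apply: gf_sub; first exact: gf_sigma.
- by move=> k D nk; apply: gf_W; exact: ltnW.
- by move=> k J nk; apply: gf_eta; exact: ltnW.
Qed.

Lemma gf_backward : backward_filtration gf.
Proof. by move=> n; split; [exact: gf_sigma|exact: gf_meas|exact: gf_dec]. Qed.

(** The first element of the filtration omits the mark of time 0, which is
    constant; its events are events of the trajectory of the process. *)
Lemma gf_path B : gf 0 B -> exists2 C : set (path_space A), measurable C & B = path_of W eta @^-1` C.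
Proof.
move=> GB.
have sK : sigma_algebra setT (preimage_set_system setT (path_of W eta) (@measurable _ (path_space A))).
  by apply: sigma_algebra_preimage; exact: sigma_algebra_measurable.
suff /(_ _ GB)[C mC <-] : gf 0 `<=` preimage_set_system setT (path_of W eta) (@measurable _ (path_space A)).
  by exists C => //; rewrite setTI.
have cyl k (D : set (gewp_state A k)) : measurable D ->
    measurable ([set w | D (w k)] : set (path_space A)).
  move=> mD; apply: sub_sigma_algebra; exists k => //; exists D => //.
  by rewrite setTI.
apply: gf_sub => //.
- move=> k D _ mD; exists [set w | D (w k).1] => //.
    apply: (cyl k (fst @^-1` D)).
    by rewrite -[X in measurable X]setTI; exact: measurable_fst.
  by rewrite setTI.
- move=> k J _; exists [set w | J (w k.+1).2] => //.
    apply: (cyl k.+1 (snd @^-1` J)).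
    by rewrite -[X in measurable X]setTI; exact: measurable_snd.
  by rewrite setTI.
Qed.

(** Histories are completed, because the consistency relation of the words and
    hence all the later constructions hold almost surely only. *)
Definition hist n : set (set Omega) := completion P (gf n).
Definition mark n (x : Omega) : nat := eta n x.

Lemma hist_sigma n : sigma_algebra setT (hist n).
Proof. exact: (completion_sigma P (@gf_sigma n) (@gf_meas n)). Qed.

Lemma hist_meas n : hist n `<=` measurable.
Proof. by move=> B []. Qed.

Lemma hist_dec n : hist n.+1 `<=` hist n.
Proof. by move=> B [mB [C GC h]]; split=> //; exists C => //; exact: gf_dec. Qed.

Lemma hist_sub n : gf n `<=` hist n.
Proof. exact: (sub_completion P (@gf_meas n)). Qed.

Hypothesis gW : is_gewp W eta.

Lemma eta_m n (J : set 'I_n.+1) : measurable (eta n @^-1` J).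
Proof. by rewrite -[X in measurable X]setTI; exact: measurable_funPT. Qed.

Lemma eta_indep n (J : set 'I_n.+1) B : hist n B ->
  pr P (eta n @^-1` J `&` B) = pr P (eta n @^-1` J) * pr P B.
Proof.
move=> /(completionP P (@gf_meas n))[mB [C GC h]].
have mC := gf_meas GC; have mJ := eta_m J.
rewrite (@pr_ae _ _ _ P _ (eta n @^-1` J `&` C)); last 3 first.
- exact: measurableI.
- exact: measurableI.
- by apply: filterS h => x [h1 h2]; split=> -[? ?]; split=> //; tauto.
rewrite (pr_ae mB mC h).
have [_ hind _] := gW n.
by have := hind J C I GC; rewrite /pr => ->; rewrite fineM// fin_num_measure.
Qed.

Lemma mark_innovation : innovation P hist mark.
Proof.
move=> n; split; [exact: hist_sigma|exact: hist_meas|exact: hist_dec| |].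
  split; last by move=> x; rewrite -ltnS ltn_ord.
  by move=> k; apply: hist_sub; exact: (@gf_eta n n [set i | i = k :> nat]).
move=> c B cn hB.
have e : [set x | mark n x = c] = eta n @^-1` [set inord c].
  apply/seteqP; split=> x /=; rewrite /mark.
    by move=> <-; rewrite inord_val.
  by move=> ->; rewrite inordK.
rewrite e eta_indep//.
have [hu _ _] := gW n.
by rewrite {1}/pr hu /= mulrC.
Qed.

(** A tail event belongs to every history, so conditioning on it affects neither
    the uniformity of a mark nor its independence of the history. *)
Lemma cond_gewp B (mB : measurable B) (B0 : pr P B != 0) : (forall n, hist n B) ->
  @is_gewp R dA A d Omega (cond P mB) W eta.
Proof.
move=> hB n; split.
- move=> i; rewrite condE//; last exact: eta_m.
  by rewrite eta_indep// mulfK//; have [hu _ _] := gW n; rewrite /pr hu.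
- move=> J D mJ GD; have mD : measurable D by exact: (gf_meas GD).
  have mJ' := eta_m J.
  rewrite !condE//; last exact: measurableI.
  rewrite -setIA !eta_indep//; last first.
    by apply: (sa_and (@hist_sigma n)) => //; exact: hist_sub.
  by rewrite -EFinM mulfK// mulrA.
- by apply: cond_ae => //; have [_ _] := gW n.
Qed.

End gewp_basics.

Section tail.
Context (R : realType) dA (A : measurableType dA)
  d (Omega : measurableType d) (P : probability Omega R).
Variables (W : forall n, {RV P >-> n.+1.-tuple A})
  (eta : forall n, {RV P >-> 'I_n.+1}).

(** If 0 < P(B) < 1 for a tail event B, the law of the process is a mixture of its
    laws conditioned on B and on the complement of B.  By extremality the first
    is the law itself; evaluated on B, which is almost surely an event of the
    trajectory, this says that P(B | B) = P(B). *)
Lemma tail_trivial : ergodic_gewp W eta ->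
  forall B, (forall n, hist W eta n B) -> pr P B = 0 \/ pr P B = 1.
Proof.
move=> [gW [_ ext]] B hB.
have [B0|B0] := eqVneq (pr P B) 0; first by left.
have [B1|B1] := eqVneq (pr P B) 1; first by right.
have mB : measurable B by case: (hB 0%N).
have mBc : measurable (~` B) by exact: measurableC.
have prC : pr P (~` B) = 1 - pr P B.
  by rewrite /pr probability_setC// fineB// fin_num_measure.
have C0 : pr P (~` B) != 0 by rewrite prC subr_eq0 eq_sym.
have hC n : hist W eta n (~` B) by exact: (sa_not (@hist_sigma _ _ _ _ _ _ W eta n)).
pose mu1 : probability (path_space A) R := @process_law R dA A d Omega (cond P mB) W eta.
pose mu2 : probability (path_space A) R := @process_law R dA A d Omega (cond P mBc) W eta.
have mpath C : measurable C -> measurable (path_of W eta @^-1` C).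
  by move=> mC; rewrite -[X in measurable X]setTI; exact: path_of_measurable.
have g1 : @gewp_laws R dA A mu1.
  by exists d, Omega, (cond P mB), W, eta; split=> //; exact: cond_gewp.
have g2 : @gewp_laws R dA A mu2.
  by exists d, Omega, (cond P mBc), W, eta; split=> //; exact: cond_gewp.
have t01 : 0 < pr P B < 1.
  by rewrite lt_neqAle eq_sym B0 pr_ge0 lt_neqAle B1 pr_le1.
have [] := ext mu1 mu2 (pr P B) g1 g2 t01.
  move=> C mC; rewrite /mu1 /mu2 /process_law /= /distribution /= /pushforward.
  rewrite !condE//; try exact: mpath.
  rewrite -prC -!EFinM mulrCA divff// mulr1 mulrCA divff// mulr1 -EFinD.
  set D := path_of W eta @^-1` C.
  have mD : measurable D by exact: mpath.
  rewrite (prE P mD); congr (_%:E).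
  have hD : measurable (D `&` B) by exact: measurableI.
  have hD' : measurable (D `&` ~` B) by exact: measurableI.
  have : P D = (P (D `&` B) + P (D `&` ~` B))%E.
    rewrite -measureU//.
      by congr (P _); rewrite -setIUr setUv setIT.
    by rewrite setIACA setICr setI0.
  by rewrite (prE P mD) (prE P hD) (prE P hD') -EFinD => -[].
move=> same _; right.
have [_ [B' GB' ae]] := (completionP P (@gf_meas _ _ _ _ _ _ W eta 0) B).1 (hB 0%N).
have [C mC eC] := gf_path GB'.
have mB' : measurable B' by exact: (gf_meas GB').
have := same C mC; rewrite /mu1 /process_law /= /distribution /= /pushforward -eC.
rewrite condE// (prE P mB') => -[].
rewrite (pr_ae (B := B)) ?divff//; last 2 first.
- exact: measurableI.
- by apply: filterS ae => x [h1 h2]; split=> [[]//|Bx]; split=> //; exact: h1.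
by move=> ->; apply: pr_ae => //.
Qed.

End tail.

(** * Independence of uniform marks *)

Section independence.
Context {R : realType} {d} {T : measurableType d} (P : probability T R).
Context (F : nat -> set (set T)) (h : nat -> T -> nat).
Hypothesis inn : innovation P F h.
Local Notation pr := (pr P).

Lemma inn_indep n (Q : nat -> Prop) C : F n C ->
  pr ([set x | Q (h n x)] `&` C) = pr [set x | Q (h n x)] * pr C.
Proof.
move=> FC; have sF := inn_sigma inn n; have mC := inn_meas inn FC.
have mQ : measurable [set x | Q (h n x)] by exact: (nm_pred sa_measurable Q (inn_hm inn n)).
case: (inn n) => _ _ _ _ hu.
have main D : F n D -> pr ([set x | Q (h n x)] `&` D) =
    (\sum_(c < n.+1) `[< Q c >]%:R / n.+1%:R) * pr D.
  move=> FD; have mD := inn_meas inn FD.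
  rewrite (pr_partition (K := n) P (inn_le inn n) (inn_hm inn n)); last exact: measurableI.
  rewrite mulr_suml; apply: eq_bigr => c _.
  case: asboolP => Qc; last first.
    rewrite !mul0r (_ : _ `&` _ = set0) ?pr0//.
    by apply/seteqP; split=> x //= [hx [Qx _]]; apply: Qc; rewrite -hx.
  rewrite mul1r mulrC -(hu c D)//; last by rewrite -ltnS.
  congr pr; apply/seteqP; split=> x /=; first by move=> [? []].
  by move=> [hx ?]; split=> //; split=> //; rewrite hx.
have := main setT (sa_cst sF True); rewrite setIT prT mulr1 => ->.
exact: main.
Qed.

Lemma inn_indep_seq (s : seq nat) (Q : nat -> nat -> Prop) : uniq s ->
  pr [set x | forall k, k \in s -> Q k (h k x)] =
  \prod_(k <- s) pr [set x | Q k (h k x)].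
Proof.
move=> us.
transitivity (\prod_(k <- sort leq s) pr [set x | Q k (h k x)]); last first.
  by apply: perm_big; rewrite perm_sort.
have -> : [set x | forall k, k \in s -> Q k (h k x)] =
    [set x | forall k, k \in sort leq s -> Q k (h k x)].
  by apply/seteqP; split=> x hx k; [rewrite mem_sort|rewrite -(mem_sort leq)]; exact: hx.
have : sorted ltn (sort leq s) by rewrite ltn_sorted_uniq_leq sort_uniq us sort_sorted//; exact: leq_total.
elim: (sort leq s) => [|a r IH]; first by rewrite big_nil (_ : [set x | _] = setT) ?prT//; apply/seteqP; split.
move=> ar; rewrite big_cons -IH; last exact: path_sorted ar.
have alla k : k \in r -> (a < k)%N.
  by move: ar => /= /(order_path_min ltn_trans)/allP; apply.
rewrite -inn_indep; last first.
  apply: (sa_all (inn_sigma inn a)) => k.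
  have [/alla ak|kr] := boolP (k \in r); last first.
    rewrite (_ : [set x | _] = [set _ | True]); first exact: (sa_cst (inn_sigma inn a)).
    by apply/seteqP; split.
  apply: (sa_imp (inn_sigma inn a)); first exact: (sa_cst (inn_sigma inn a)).
  case: k ak => // k ak; apply: (inn_dec inn (n := a) (m := k)) => //.
  exact: (nm_pred (inn_sigma inn k) (Q k.+1) (inn_nm inn k)).
congr pr; apply/seteqP; split=> x /=.
  move=> hx; split; first by apply: hx; rewrite mem_head.
  by move=> k kr; apply: hx; rewrite in_cons kr orbT.
by move=> [Qa hr] k; rewrite in_cons => /predU1P[->//|]; exact: hr.
Qed.

End independence.

(** * Recovering words and marks from the new innovations *)

Lemma rational_rays_measurable (R : realType) (T : Type) (G : set (set T)) (g : T -> R) :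
  sigma_algebra setT G -> (forall q : rat, G [set x | g x < ratr q]) ->
  forall D : set R, measurable D -> G (g @^-1` D).
Proof.
move=> sG hq D mD.
have main : @measurable _ R `<=` [set D | G (g @^-1` D)].
  have -> : @measurable _ R = <<s @RGenInftyO.G R >> by exact: RGenInftyO.measurableE.
  apply: smallest_sub.
    split.
    - by rewrite /= preimage_set0; case: sG.
    - by move=> B GB /=; rewrite setTD preimage_setC; exact: (sa_not sG).
    - by move=> B GB /=; rewrite preimage_bigcup; case: sG => _ _; apply.
  move=> B [s ->] /=.
  rewrite (_ : _ @^-1` _ = [set x | exists q : rat, ratr q <= s /\ g x < ratr q]).
    by apply: (sa_ex sG) => q; apply: (sa_and sG); [exact: (sa_cst sG)|exact: hq].
  apply/seteqP; split=> x /=; rewrite in_itv/=.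
    move=> gs; have [q] := rat_in_itvoo gs; rewrite in_itv/= => /andP[gq qs].
    by exists q; split=> //; exact: ltW.
  by move=> [q [qs gq]]; exact: lt_le_trans gq qs.
exact: main.
Qed.

Lemma rv_family (R : realType) d (T : measurableType d) (P : probability T R)
  (f : nat -> T -> R) : (forall k, measurable_fun setT (f k)) ->
  exists g : nat -> {RV P >-> R}, forall k x, g k x = f k x.
Proof.
move=> mf; have /choice[g hg] : forall k, exists g : {RV P >-> R}, forall x, g x = f k x.
  move=> k; pose M := isMeasurableFun.Build _ _ _ _ (f k) (mf k).
  by exists (HB.pack_for {mfun T >-> R} (f k) M).
by exists g.
Qed.

(** Good is an event of probability one on which all the consistency relations
    hold.  The codes vanish outside it, so that they follow the letters
    everywhere. *)
Section code.
Context (R : realType) dA (A : measurableType dA)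
  d (Omega : measurableType d) (P : probability Omega R).
Variables (W : forall n, {RV P >-> n.+1.-tuple A})
  (eta : forall n, {RV P >-> 'I_n.+1}).
Hypothesis erg : ergodic_gewp W eta.
Let gW : is_gewp W eta := erg.1.
Variable f : A -> R.
Hypotheses (mf : measurable_fun setT f) (finj : injective f)
  (fim : forall B : set A, measurable B -> measurable (f @` B)).
Variable Good : set Omega.
Hypotheses (mG : measurable Good) (aeG : {ae P, forall x, Good x}).
Hypothesis Ger : forall x, Good x -> forall n, W n x = erase (W n.+1 x) (eta n.+1 x).

Local Notation H := (hist W eta).
Local Notation h := (mark eta).
Let inn : innovation P H h := mark_innovation gW.
Let sH n : sigma_algebra setT (H n) := hist_sigma W eta n.

(** Bits (a, b) of a code locate the asymptotic position with respect to a/b,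
    and bits q locate the image of the letter under f with respect to q. *)
Definition index : countType := ((nat * nat) + rat)%type.

Definition letter n j (x : Omega) : R := f (tnth (W n x) (inord j)).

Definition code_event n j x (i : index) : Prop :=
  match i with inl ab => below h ab.1 ab.2 n j x | inr q => letter n j x < ratr q end.

Definition code n j (x : Omega) (l : nat) : bool :=
  `[< Good x /\ if unpickle l is Some i then code_event n j x i else False >].

Lemma hist_full n B : measurable B -> {ae P, forall x, B x} -> H n B.
Proof. exact: (completion_full (@gf_sigma _ _ _ _ _ _ W eta n) (@gf_meas _ _ _ _ _ _ W eta n)). Qed.

Lemma letter_m n j D : measurable D -> H n [set x | D (letter n j x)].
Proof.
move=> mD; apply: hist_sub.
have m1 : measurable ((fun w : n.+1.-tuple A => f (tnth w (inord j))) @^-1` D).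
  rewrite -[X in measurable X]setTI.
  have : measurable_fun setT (f \o (fun w : n.+1.-tuple A => tnth w (inord j))).
    by apply: measurableT_comp => //; exact: measurable_tnth.
  by apply.
exact: (@gf_W _ _ _ _ _ _ W eta n n _ (leqnn n) m1).
Qed.

Lemma code_event_m n j i : H n [set x | code_event n j x i].
Proof.
case: i => [[a b]|q]; last first.
  have := @letter_m n j `]-oo, ratr q[ (measurable_itv _).
  by congr (H n _); apply/seteqP; split=> x /=; rewrite in_itv.
apply: (sa_ex (sH n)) => m; apply: (sa_all (sH n)) => k.
apply: (sa_imp (sH n)); first exact: (sa_cst (sH n)).
have pm := past_measurable (h := h) (n := n) (m := (4 ^ k - n)%N) (sH n).
apply: pm; last first.
  exact: (past_fun_past (Q := fun c => (c * b < a * (4 ^ k).+2)%N : Prop) (@cut_past _ h n (4 ^ k - n) j.+1)).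
case=> // l /andP[nl _]; have := inn_nm inn l => hl c.
exact: (inn_dec inn (n := n) (m := l)).
Qed.

Lemma code_m n j l : H n [set x | code n j x l].
Proof.
rewrite (_ : [set x | _] = [set x | Good x /\ if unpickle l is Some i then code_event n j x i else False]).
  apply: (sa_and (sH n)); first exact: hist_full.
  by case: (unpickle l) => [i|]; [exact: code_event_m|exact: (sa_cst (sH n))].
by apply/seteqP; split=> x; rewrite /mkset /code => /asboolP.
Qed.

Lemma code_step n j x : (j <= n)%N -> code n j x = code n.+1 (bump (h n.+1 x) j) x.
Proof.
move=> jn; apply/funext => l; rewrite /code.
suff e i : Good x -> (code_event n j x i <-> code_event n.+1 (bump (h n.+1 x) j) x i).
  apply/asboolP/asboolP => -[Gx]; case: (unpickle l) => [i|//] hi; split=> //.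
    exact: (e i Gx).1.
  exact: (e i Gx).2.
move=> Gx; case: i => [[a b]|q] /=.
  have ce k : (n < k)%N -> cutpos h n (4 ^ k - n) j.+1 x =
     cutpos h n.+1 (4 ^ k - n.+1) (bump (h n.+1 x) j).+1 x.
    move=> nk; have nk4 : (n < 4 ^ k)%N by rewrite (ltn_trans nk)// ltn_expl.
    have -> : (4 ^ k - n = (4 ^ k - n.+1).+1)%N by rewrite subnSK.
    by rewrite /= addSn /bump ltnS addnC.
  split=> -[m hm]; exists (maxn m n.+1) => k; rewrite geq_max => /andP[mk nk].
    by rewrite -ce//; exact: hm.
  by rewrite ce//; exact: hm.
suff -> : letter n j x = letter n.+1 (bump (h n.+1 x) j) x by [].
rewrite /letter (Ger Gx) /erase tnth_mktuple; congr (f (tnth _ _)).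
apply/val_inj; rewrite /= !inordK//.
have : (h n.+1 x <= n.+1)%N by exact: (inn_le inn).
by rewrite ltnS /bump; case: (leqP _ j); lia.
Qed.

(** The asymptotic positions within a word are distinct, and in the order of the
    letters. *)
Definition ord_sep (x : Omega) := forall n i j, (i < j)%N -> (j <= n)%N ->
  exists a b, below h a b n i x /\ ~ below h a b n j x.

Lemma ord_sep_ae : {ae P, forall x, ord_sep x}.
Proof.
apply: ae_foralln => n; apply: ae_foralln => i; apply: ae_foralln => j.
have [ij|ji] := ltnP i j; last by apply: aeW.
have [jn|nj] := leqP j n; last by apply: aeW.
by apply: filterS (below_separates inn ij jn) => x hx _ _.
Qed.

Lemma code_below n j x a b : Good x ->
  code n j x (pickle (inl (a, b) : index)) <-> below h a b n j x.
Proof.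
move=> Gx; rewrite /code pickleK; split; first by move/asboolP => [].
by move=> hb; apply/asboolP.
Qed.

Lemma code_letter n j x q : Good x ->
  code n j x (pickle (inr q : index)) <-> letter n j x < ratr q.
Proof.
move=> Gx; rewrite /code pickleK; split; first by move/asboolP => [].
by move=> hb; apply/asboolP.
Qed.

Lemma code_sep : {ae P, forall x, forall n, sep_at code n x}.
Proof.
apply: filterS2 aeG ord_sep_ae => x Gx ox n i j iN jn ij.
apply: lexlt_total.
wlog ij' : i j iN jn {ij} / (i < j)%N.
  move=> hw; have [lt|lt|e] := ltngtP i j; last by rewrite e eqxx in ij.
    exact: hw.
  by have [l hl] := hw j i jn iN lt; exists l; rewrite eq_sym.
have [a [b [hi nj]]] := ox n i j ij' jn.
exists (pickle (inl (a, b) : index)).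
by rewrite (code_below _ _ _ _ Gx).2//; apply/eqP => e; apply: nj; apply/(code_below _ _ _ _ Gx); rewrite -e.
Qed.

Lemma below_mono a b n i j x : (i <= j)%N -> below h a b n j x -> below h a b n i x.
Proof.
move=> ij [m hm]; exists m => k mk; apply: leq_ltn_trans (hm k mk).
rewrite leq_mul2r; apply/orP; right.
by move: ij; rewrite leq_eqVlt => /predU1P[->//|ij]; apply: ltnW; exact: cut_lt.
Qed.

(** The new marks; the generating sequence of the filtration. *)
Definition innov := resorted h code.

Lemma innov_innovation : innovation P H innov.
Proof. exact: (resorted_innovation inn hist_full code_m code_sep). Qed.

Section recover.
Variables (G : set (set Omega)) (n : nat).
Hypotheses (sG : sigma_algebra setT G) (Gm : G `<=` measurable).
Hypothesis Gmarks : forall k, (n < k)%N -> nat_measurable G (innov k).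
Let G' := completion P G.
Let sG' : sigma_algebra setT G' := completion_sigma P sG Gm.
Local Notation vp := (vpos code n).

Lemma code_vpos_G i l : (i <= n)%N -> G' [set x | code n (vp i x) x l].
Proof.
exact: (vpos_bits_completion inn hist_full (tail_trivial erg) code_m code_step code_sep sG Gm Gmarks).
Qed.

Lemma vpos_m i k : measurable [set x | vp i x = k].
Proof. by apply: (hist_meas (W := W) (eta := eta) (n := n)); exact: (vpos_nm inn code_m). Qed.

(** The letter of rank i stands at the place equal to the number of letters with
    a smaller asymptotic position, and these comparisons are made on the
    codes. *)
Lemma vpos_G i : (i <= n)%N -> nat_measurable G' (vp i).
Proof.
move=> iN j.
pose left i' x := exists a b, code n (vp i' x) x (pickle (inl (a, b) : index)) /\
  ~ code n (vp i x) x (pickle (inl (a, b) : index)).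
have mleft i' : (i' < n.+1)%N -> G' [set x | left i' x].
  move=> i'n; apply: (sa_ex sG') => a; apply: (sa_ex sG') => b; apply: (sa_and sG').
    exact: code_vpos_G.
  by apply: (sa_not sG'); exact: code_vpos_G.
have mcount : nat_measurable G' (fun x => (\sum_(i' < n.+1) `[< left i' x >])%N).
  apply: (nm_sum sG' (f := fun i' x => `[< left i' x >] : nat)) => i' i'n.
  apply: (nm_bool sG'); rewrite (_ : [set x | _] = [set x | left i' x]); first exact: mleft.
  by apply/seteqP; split=> x; rewrite /mkset => /asboolP.
apply: (completion_ae Gm (mcount j)); first exact: vpos_m.
apply: filterS3 aeG ord_sep_ae code_sep => x Gx ox sx.
suff e : (\sum_(i' < n.+1) `[< left i' x >])%N = vp i x by rewrite /= e.
rewrite -[RHS](unrank_count lexlt_irr lexlt_trans (sx n) iN).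
apply: eq_bigr => i' _; congr nat_of_bool.
have i'n : (i' <= n)%N by rewrite -ltnS.
have [ui _] := unrankK lexlt_irr lexlt_trans (sx n) iN.
have [ui' _] := unrankK lexlt_irr lexlt_trans (sx n) i'n.
rewrite -/(vp i x) -/(vp i' x) in ui ui' *.
apply/asboolP/idP => [[a [b [hb nb]]]|lt].
  rewrite ltnNge; apply/negP => le; apply: nb; apply/(code_below _ _ _ _ Gx).
  by apply: below_mono le _; apply/(code_below _ _ _ _ Gx).
have [a [b [hb nb]]] := ox n _ _ lt ui.
exists a, b; split; first by apply/(code_below _ _ _ _ Gx).
by move/(code_below _ _ _ _ Gx).
Qed.

Lemma letter_vpos_G i D : (i <= n)%N -> measurable D -> G' [set x | D (letter n (vp i x) x)].
Proof.
move=> iN; apply: (rational_rays_measurable sG') => q.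
apply: (completion_ae Gm (code_vpos_G (pickle (inr q : index)) iN)).
  apply: (nm_pick sa_measurable (g := vp i) (A := fun k x => letter n k x < ratr q)).
    by move=> k; exact: vpos_m.
  by move=> k; apply: (hist_meas (W := W) (eta := eta) (n := n)); exact: (code_event_m n k (inr q)).
by apply: filterS aeG => x Gx; exact: code_letter.
Qed.

(** The letter at place j is the one whose rank i satisfies [vpos i = j]; it is
    known through f, which is injective and maps measurable sets to measurable
    sets. *)
Lemma word_G (D : set (n.+1.-tuple A)) : measurable D -> G' (W n @^-1` D).
Proof.
have eS B : <<s G' >> B <-> G' B by rewrite (sigma_algebra_id sG').
have mW : measurable_fun setT (W n : g_sigma_algebraType G' -> n.+1.-tuple A).
  apply/measurable_fun_tnthP => j _ B mB; rewrite setTI.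
  suff : G' (((@tnth n.+1 A)^~ j \o W n) @^-1` B) by move/eS.
  have E : G' [set x | exists i, (i <= n)%N /\ (vp i x = j /\ (f @` B) (letter n (vp i x) x))].
    apply: (sa_ex sG') => i; have [iN|iN] := leqP i n; last first.
      rewrite (_ : [set x | _] = [set _ | False]); first exact: (sa_cst sG').
      by apply/seteqP; split=> x //= [].
    apply: (sa_and sG'); first exact: (sa_cst sG').
    apply: (sa_and sG'); first exact: vpos_G.
    by apply: letter_vpos_G => //; exact: fim.
  apply: (completion_ae Gm E).
    have : measurable_fun setT ((@tnth n.+1 A)^~ j \o W n).
      by apply: measurableT_comp; [exact: measurable_tnth|exact: measurable_funPT].
    by move=> /(_ measurableT B mB); rewrite setTI.
  apply: filterS code_sep => x sx; split=> /=.
    move=> [i [iN [-> ]]]; rewrite /letter inord_val => -[a Ba /finj <-] //.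
  move=> Bj; exists (vrank code n j x).
  have jn : (j <= n)%N by rewrite -ltnS.
  have e : vp (vrank code n j x) x = j by exact: (rankK lexlt_irr lexlt_trans (sx n) jn).
  split; first exact: (rank_le lexlt_irr).
  by rewrite e; split=> //; rewrite /letter inord_val; exists (tnth (W n x) j).
by move=> mD; apply/eS; have := mW measurableT D mD; rewrite setTI.
Qed.

End recover.

(** The original mark of time n + 1 is the place, in the word n + 1, of the letter
    whose rank is the new mark. *)
Lemma eta_G (G : set (set Omega)) n : sigma_algebra setT G -> G `<=` measurable ->
  (forall k, (n < k)%N -> nat_measurable G (innov k)) ->
  forall J : set 'I_n.+2, completion P G (eta n.+1 @^-1` J).
Proof.
move=> sG Gm Gmarks J; have sG' := completion_sigma P sG Gm.
have Gmarks' k : (n.+1 < k)%N -> nat_measurable G (innov k) by move=> nk; apply: Gmarks; exact: ltnW.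
have E : completion P G [set x | (innov n.+1 x <= n.+1)%N /\ J (inord (vpos code n.+1 (innov n.+1 x) x))].
  apply: (nm_pick sG' (g := innov n.+1)
    (A := fun c x => (c <= n.+1)%N /\ J (inord (vpos code n.+1 c x)))).
    by move=> k; apply: (sub_completion P Gm); exact: Gmarks.
  move=> c; have [cn|cn] := leqP c n.+1; last first.
    rewrite (_ : [set x | _] = [set _ | False]); first exact: (sa_cst sG').
    by apply/seteqP; split=> x //= [].
  apply: (sa_and sG'); first exact: (sa_cst sG').
  exact: (nm_pred sG' (fun k => J (inord k)) (vpos_G sG Gm Gmarks' cn)).
apply: (completion_ae Gm E); first exact: eta_m.
apply: filterS code_sep => x sx.
have hn : (h n.+1 x <= n.+1)%N by exact: (inn_le inn).
have xn : (innov n.+1 x <= n.+1)%N by exact: (rank_le lexlt_irr).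
have e : vpos code n.+1 (innov n.+1 x) x = h n.+1 x.
  exact: (rankK lexlt_irr lexlt_trans (sx n.+1) hn).
by rewrite /= e inord_val; split=> [[]|].
Qed.

Lemma product_type_code : product_type P (gewp_filtration W eta).
Proof.
split; first exact: gf_backward.
have innM k : nat_measurable measurable (innov k) by exact: (inn_hm innov_innovation).
have [|X hX] := @rv_family R d Omega P (fun k x => (innov k x)%:R).
  move=> k; case: (bounded_mfun_nat (R := R) (K := k) (innM k)) => // x.
  exact: (inn_le innov_innovation).
have preX k D : X k @^-1` D = [set x | D (innov k x)%:R].
  by apply/seteqP; split=> x /=; rewrite hX.
exists X; split.
  move=> s B us mB.
  have mXB k : measurable (X k @^-1` B k).
    by rewrite preX; exact: (nm_pred sa_measurable (fun a => B k a%:R) (innM k)).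
  have -> : \bigcap_(k in [set` s]) (X k @^-1` B k) =
      [set x | forall k, k \in s -> B k (innov k x)%:R].
    by apply/seteqP; split=> x hx k /= ks; have := hx k ks; rewrite /= hX.
  rewrite (prE P); last first.
    apply: (sa_all sa_measurable) => k; apply: (sa_imp sa_measurable); first exact: (sa_cst sa_measurable).
    exact: (nm_pred sa_measurable (fun a => B k a%:R) (innM k)).
  rewrite (inn_indep_seq innov_innovation (fun k a => B k a%:R) us).
  rewrite -prodEFin; apply: eq_bigr => k _.
  by rewrite (prE P (mXB k)) preX.
move=> n; set Gn := <<s _ >>.
have sGn m : sigma_algebra setT <<s \bigcup_(k in [set k | (m.+1 <= k)%N])
            preimage_set_system setT (X k) measurable >>.
  exact: smallest_sigma_algebra.
have XG m k D : (m < k)%N -> measurable D -> <<s \bigcup_(k in [set k | (m.+1 <= k)%N])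
            preimage_set_system setT (X k) measurable >> (X k @^-1` D).
  move=> mk mD; apply: sub_sigma_algebra; exists k => //.
  by exists D => //; rewrite setTI.
have innG m k : (m < k)%N -> nat_measurable <<s \bigcup_(k in [set k | (m.+1 <= k)%N])
            preimage_set_system setT (X k) measurable >> (innov k).
  move=> mk a; rewrite (_ : [set x | _] = X k @^-1` [set a%:R]).
    by apply: XG => //; exact: measurable_set1.
  rewrite preX; apply/seteqP; split=> x /=; first by move=> ->.
  by move/eqP; rewrite eqr_nat => /eqP.
have GnH : Gn `<=` completion P (gewp_filtration W eta n).
  apply: smallest_sub; first exact: sH.
  move=> B [k /= nk [D mD <-]]; rewrite setTI preX.
  case: k nk => // k nk; apply: (inn_dec inn (n := n) (m := k)) => //.
  exact: (nm_pred (sH k) (fun a => D a%:R) (inn_nm innov_innovation k)).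
have Gnm : Gn `<=` measurable by move=> B /GnH [].
have sc : sigma_algebra setT (completion P Gn) := completion_sigma P (sGn n) Gnm.
split.
  move=> B GB.
  have : completion P Gn B.
    move: B GB; apply: gf_sub => //.
    - move=> k D nk mD.
      have Gk k' : (k < k')%N -> nat_measurable Gn (innov k').
        by move=> kk'; apply: innG; exact: leq_ltn_trans kk'.
      exact: (word_G (sGn n) Gnm Gk).
    - move=> k J nk.
      have Gk k' : (k < k')%N -> nat_measurable Gn (innov k').
        by move=> kk'; apply: innG; exact: leq_ltn_trans kk'.
      exact: (eta_G (sGn n) Gnm Gk).
  by case.
move=> C /GnH[mC [B GB BC]]; exists B => //.
by rewrite setYC.
Qed.

End code.

Theorem theorem3 (R : realType) (dA : measure_display) (A : measurableType dA)
    (d : measure_display) (Omega : measurableType d) (P : probability Omega R)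
    (W : forall n : nat, {RV P >-> n.+1.-tuple A})
    (eta : forall n : nat, {RV P >-> 'I_n.+1}) :
  borel_space R A ->
  ergodic_gewp W eta ->
  product_type P (gewp_filtration W eta).
Proof.
move=> [E [f [_ _ [_ fbij _] mf fim]]] erg.
have finj : injective f by move=> a b e; apply: fbij e; rewrite inE.
have : {ae P, forall x, forall n, W n x = erase (W n.+1 x) (eta n.+1 x)}.
  by apply: ae_foralln => n; have [_ _] := erg.1 n.
move=> [N [mN N0 sub]].
apply: (@product_type_code _ _ _ _ _ _ _ _ erg f mf finj fim (~` N)).
- exact: measurableC.
- by exists N; split => // x /= /contrapT.
- by move=> x nN; apply: contrapT => h; apply: nN; apply: sub.
Qed.
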